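(* Let $G$ be a finite group, $K\le G$, $(\theta,V)$ an irreducible representation of $K$, and let $K=H_1\le H_2\le\cdots\le H_m=G$ be a chain of subgroups satisfying the Gelfand–Tsetlin condition (relative to $\theta$). Let $\sigma\in J$ with representation space $W$. Then the orthonormal basis $$\left\{\sqrt{\frac{d_\sigma}{d_\theta}}\,(L_{\sigma,C}^* )^\vee:\ C\in\mathcal P(\sigma)\right\}$$ of $\mathrm{Hom}_G(W,\mathrm{Ind}_K^GV)$ gives rise precisely to the isometric orthogonal decomposition $\bigoplus_{C\in\mathcal P(\sigma)}W_C$ of the $\sigma$-isotypic component of $\mathrm{Ind}_K^GV$, that is, $$W_C=\sqrt{\frac{d_\sigma}{d_\theta}}\,(L_{\sigma,C}^* )^\vee W\qquad\text{for every }C\in\mathcal P(\sigma).$$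
   Context: All representations are finite-dimensional, complex and unitary; $d_\sigma$ is the dimension of $\sigma$; $T^*$ is the adjoint of $T$; $\widehat H$ is a complete set of pairwise inequivalent irreducible representations of $H$. $\mathrm{Hom}(A,B)$ and its subspaces carry the scalar product $\langle T_1,T_2\rangle=\frac1{\dim A}\mathrm{tr}(T_2^*T_1)$; $\mathrm{Hom}_G,\mathrm{Hom}_K$ are spaces of intertwining operators. For $H\le G$ and an $H$-representation $(\rho,Z)$, $\mathrm{Ind}_H^GZ=\{f:G\to Z:f(gh)=\rho(h^{-1})f(g)\ \forall g\in G,h\in H\}$ with $[\lambda(g_0)f](g)=f(g_0^{-1}g)$ and scalar product $\frac1{|H|}\sum_{g\in G}\langle f_1(g),f_2(g)\rangle$. For $K\le H\le G$ one identifies $\mathrm{Ind}_H^G[\mathrm{Ind}_K^HV]$ with $\mathrm{Ind}_K^GV$: elements of the former are the functions $F:G\times H\to V$ with $F(gh,h_0k)=\theta(k^{-1})F(g,hh_0)$, and $F$ corresponds to $f(g)=F(g,1)$. For $L\in\mathrm{Hom}_K(\mathrm{Res}^G_KW,V)$, $L^\vee\in\mathrm{Hom}_G(W,\mathrm{Ind}_K^GV)$ is $[L^\vee w](g)=\frac1{\sqrt{|G/K|}}L\sigma(g^{-1})w$. Isometric orthogonal decomposition of an isotypic component: if $W$ is $G$-irreducible and $n=\dim\mathrm{Hom}_G(W,U)$, operators $T_1,\dots,T_n\in\mathrm{Hom}_G(W,U)$ give rise to the isometric orthogonal decomposition $T_1W\oplus\cdots\oplus T_nW$ of the $W$-isotypic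 component of $U$ if $\langle T_iw_1,T_jw_2\rangle=\delta_{i,j}\langle w_1,w_2\rangle$. Gelfand–Tsetlin setting: $J$ is the set of irreducible $G$-representations contained in $\mathrm{Ind}_K^GV$. Put $J_1=\{\theta\}$ and recursively let $J_{\ell+1}$ be the set of all $\eta\in\widehat{H_{\ell+1}}$ contained in $\mathrm{Ind}_{H_\ell}^{H_{\ell+1}}\rho$ for some $\rho\in J_\ell$, $\ell=1,\ldots,m-1$ (so $J_m=J$). The chain satisfies the Gelfand–Tsetlin condition if for all $1\le\ell\le m-1$, $\rho\in J_\ell$, $\eta\in J_{\ell+1}$ the multiplicity of $\eta$ in $\mathrm{Ind}_{H_\ell}^{H_{\ell+1}}\rho$ (equivalently of $\rho$ in $\mathrm{Res}^{H_{\ell+1}}_{H_\ell}\eta$) is at most $1$; write $\eta\to\rho$ when it is $1$. For $\sigma\in J$, $\mathcal P(\sigma)$ is the set of all paths $C:\rho_m\to\rho_{m-1}\to\cdots\to\rho_1$ with $\rho_\ell\in J_\ell$, $\rho_m=\sigma$, $\rho_1=\theta$. Restriction side: for $C\in\mathcal P(\sigma)$ set $W_m=W$ and, for $\ell=m-1,\ldots,1$, let $W_\ell$ be the unique subspace of $\mathrm{Res}^{H_{\ell+1}}_{H_\ell}W_{\ell+1}$ isomorphic to $\rho_\ell$; put $V_C=W_1$ (isomorphic to $V$ as a $K$-representation). Let $L_{\sigma,C}\in\mathrm{Hom}_K(V,\mathrm{Res}^G_KW)$ be an isometry with $L_{\sigma,C}V=V_C$ (unique up to a constant of modulus 1). The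 set $\{L_{\sigma,C}:C\in\mathcal P(\sigma)\}$ is an orthonormal basis of $\mathrm{Hom}_K(V,\mathrm{Res}^G_KW)$. Induction side: for $C\in\mathcal P(\sigma)$ set $Z_1=V$ and recursively let $Z_{\ell+1}$ be the unique subspace of $\mathrm{Ind}_{H_\ell}^{H_{\ell+1}}Z_\ell$ affording $\rho_{\ell+1}$; put $W_C=Z_m$, regarded as a subspace of $\mathrm{Ind}_K^GV=\mathrm{Ind}_{H_{m-1}}^{H_m}\cdots\mathrm{Ind}_{H_1}^{H_2}V$ via transitivity of induction, that is, by applying successively for $\ell=2,\ldots,m-1$ the identification of $\mathrm{Ind}_{H_\ell}^{H_{\ell+1}}[\mathrm{Ind}_K^{H_\ell}V]$ with $\mathrm{Ind}_K^{H_{\ell+1}}V$ under which a function $F:H_{\ell+1}\times H_\ell\to V$ with $F(gh,h_0k)=\theta(k^{-1})F(g,hh_0)$ for all $g\in H_{\ell+1}$, $h,h_0\in H_\ell$, $k\in K$, corresponds to $f(g)=F(g,1)$. Then $\bigoplus_{C\in\mathcal P(\sigma)}W_C$ is an orthogonal decomposition of the $\sigma$-isotypic component of $\mathrm{Ind}_K^GV$. *)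

(* Defs.v *)
Set Warnings "-notation-overridden,-ambiguous-paths,-redundant-canonical-projection".
From HB Require Import structures.
From mathcomp Require Import all_boot all_order all_fingroup all_algebra.
From mathcomp Require Import sesquilinear.
From mathcomp Require Import boolp classical_sets.

Set Implicit Arguments.
Unset Strict Implicit.
Unset Printing Implicit Defensive.

Import GRing.Theory Num.Theory Num.Def.
Local Open Scope ring_scope.

Section Linear.
Variables (C : fieldType) (X Y : vectType C).

(* Definite description for subspaces; 0 is a junk value. *)
Definition the_vspace (P : {vspace X} -> Prop) : {vspace X} :=
  xget 0%VS [set U | P U]%classic.

(* The subspace of the vectors satisfying a linear condition P; see
   [vspace_ofP]. *)
Definition vspace_of (P : X -> Prop) : {vspace X} :=
  the_vspace (fun U => forall x, x \in U <-> P x).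

Lemma vspace_ofP (P : X -> Prop) :
  P 0 -> (forall a u v, P u -> P v -> P (a *: u + v)) ->
  forall x, x \in vspace_of P <-> P x.
Proof.
move=> P0 PD.
suff [U PU] : exists U : {vspace X}, forall x, x \in U <-> P x.
  by have := @xgetI _ 0%VS [set V : {vspace X} | forall x, x \in V <-> P x]%classic U PU.
suff grow k (U : {vspace X}) : (forall x, x \in U -> P x) ->
    (\dim {:X} - \dim U <= k)%N ->
    exists U' : {vspace X}, forall x, x \in U' <-> P x.
  by apply: (grow _ 0%VS _ (leqnn _)) => x; rewrite memv0 => /eqP->.
elim: k U => [|k IHk] U UP leUk.
  exists U => x; split=> [/UP //|_].
  suff -> : U = fullv by rewrite memvf.
  by apply/eqP; rewrite eqEdim subvf -subn_eq0 -leqn0.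
case: (pselect (forall x, P x -> x \in U)) => [PU|].
  by exists U => x; split=> [/UP|/PU].
move/existsNP=> [x] /[!not_implyE] -[Px /negP xU].
apply: (IHk (U + <[x]>)%VS) => [y /memv_addP[u uU [v /vlineP[a ->] ->]]|].
  by rewrite addrC; apply: PD => //; apply: UP.
have ltU : (\dim U < \dim (U + <[x]>))%N.
  rewrite ltn_neqAle dimvS ?addvSl // andbT; apply: contra xU => eqd.
  have /eqP -> : U == (U + <[x]>)%VS by rewrite eqEdim addvSl (eqP eqd) leqnn.
  by rewrite (subvP (addvSr _ _)) // memv_line.
by rewrite -ltnS (leq_trans _ leUk) // ltn_sub2l // (leq_trans ltU) ?dimvS ?subvf.
Qed.

Lemma linfunE (f : X -> Y) : linear f -> linfun f =1 f.
Proof.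
move=> flin; pose lf := GRing.isLinear.Build _ _ _ _ f flin.
pose fL : {linear X -> Y} := HB.pack f lf.
exact: (lfunE fL).
Qed.

Definition lftrace (f : 'End(X)) : C :=
  \tr (passmx.mxof (vbasis {:X}) (vbasis {:X}) f).

End Linear.

Section Adjoint.
Variables (C : numClosedFieldType) (X Y : vectType C).
Variables (dX : {dot X for conjC}) (dY : {dot Y for conjC}).

Definition adjoint (T : 'Hom(X, Y)) : 'Hom(Y, X) :=
  xget 0 [set S : 'Hom(Y, X) | forall x y, dY (T x) y = dX x (S y)]%classic.

Definition hom_dot (T1 T2 : 'Hom(X, Y)) : C :=
  ((\dim {:X})%:R)^-1 * lftrace (adjoint T2 \o T1)%VF.

End Adjoint.

Section OrthonormalBasis.
Variables (C : fieldType) (E : vectType C) (J : finType).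

Definition orthonormal_basis (dE : E -> E -> C) (P : pred J) (T : J -> E)
    (S : {vspace E}) : Prop :=
  (forall i j, P i -> P j -> dE (T i) (T j) = (i == j)%:R) /\
  (\sum_(i | P i) <[T i]>)%VS = S.

End OrthonormalBasis.

(* [ract x] is only meaningful for [x \in G]. *)
Record urep (C : numClosedFieldType) (gT : finGroupType) (G : {group gT}) :=
  URep {
    carrier :> vectType C;
    rdot : {dot carrier for conjC};
    ract : gT -> 'End(carrier);
    ract1 : ract 1%g = \1%VF;
    ractM : {in G &, forall x y, ract (x * y)%g = (ract x \o ract y)%VF};
    ract_unitary : {in G, forall x u v, rdot (ract x u) (ract x v) = rdot u v}
  }.

Section Rep.
Variables (C : numClosedFieldType) (gT : finGroupType).

Section Hom.
Variables (G : {group gT}) (W : urep C G).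
(* A G-representation inside a larger space X: a : gT -> 'End(X) describes the
   action, and U is a subspace of X on which a restricts to a representation
   of G.  As only a x for x \in G matters, the restriction of a representation
   to a subgroup is described by the same a. *)
Variables (X : vectType C) (a : gT -> 'End(X)).

Definition intertwines (T : 'Hom(W, X)) : Prop :=
  {in G, forall x, (T \o ract W x)%VF = (a x \o T)%VF}.

Definition HomG (U : {vspace X}) : {vspace 'Hom(W, X)} :=
  vspace_of (fun T : 'Hom(W, X) => (forall w, T w \in U) /\ intertwines T).

Lemma HomGP U T :
  T \in HomG U <-> (forall w, T w \in U) /\ intertwines T.
Proof.
apply: vspace_ofP => [|c S1 S2 [S1U aS1] [S2U aS2]].
  split=> [w|x _]; first by rewrite lfunE mem0v.
  by rewrite comp_lfun0l comp_lfun0r.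
split=> [w|x Gx]; first by rewrite add_lfunE scale_lfunE memvD ?memvZ.
by rewrite comp_lfunDl comp_lfunDr -comp_lfunZl -comp_lfunZr aS1 ?aS2.
Qed.

(* The multiplicity of W (irreducible) in U. *)
Definition multiplicity (U : {vspace X}) : nat := \dim (HomG U).

(* U is a-stable and, as a representation of G, isomorphic to W. *)
Definition affords (U : {vspace X}) : Prop :=
  exists T : 'Hom(W, X), [/\ intertwines T, lker T == 0%VS & limg T = U].

(* The sum of all the subspaces of U affording W. *)
Definition isotypic (U : {vspace X}) : {vspace X} :=
  the_vspace (fun S : {vspace X} =>
    (forall M : {vspace X}, (M <= U)%VS -> affords M -> (M <= S)%VS) /\
    (forall S' : {vspace X},
      (forall M : {vspace X}, (M <= U)%VS -> affords M -> (M <= S')%VS) ->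
      (S <= S')%VS)).

(* The family T j, for P j, gives rise to an isometric orthogonal
   decomposition of the W-isotypic component of U. *)
Definition isometric_decomposition (dX : {dot X for conjC}) (U : {vspace X})
    (J : finType) (P : pred J) (T : J -> 'Hom(W, X)) : Prop :=
  [/\ #|P| = multiplicity U,
      forall j, P j -> T j \in HomG U &
      forall i j w1 w2, P i -> P j ->
        dX (T i w1) (T j w2) = (i == j)%:R * rdot W w1 w2].

End Hom.

Definition irreducible (G : {group gT}) (W : urep C G) : Prop :=
  {:W}%VS != 0%VS /\
  forall U : {vspace W}, {in G, forall x, (ract W x @: U <= U)%VS} ->
    U = 0%VS \/ U = fullv.

Definition equivalent (G : {group gT}) (W1 W2 : urep C G) : Prop :=
  affords W1 (ract W2) fullv.

Definition complete_irr (G : {group gT}) (I : finType) (rho : I -> urep C G) :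
    Prop :=
  [/\ forall i, irreducible (rho i),
      forall i j, equivalent (rho i) (rho j) -> i = j &
      forall W : urep C G, irreducible W -> exists i, equivalent W (rho i)].

Section Ind.
Variables (G H : {group gT}).

Definition ind_act (X : vectType C) (x : gT) :
    'End({ffun subg_of G -> X}) :=
  linfun (fun f : {ffun subg_of G -> X} =>
            [ffun g => f ((subg G x)^-1 * g)%g]).

Lemma ind_actE (X : vectType C) x f g :
  ind_act X x f g = f ((subg G x)^-1 * g)%g.
Proof.
by rewrite linfunE ?ffunE // => c f1 f2; apply/ffunP=> y; rewrite !ffunE.
Qed.

(* Ind_H^G Z, where Z is a subspace of X on which a restricts to a
   representation of H. *)
Definition ind (X : vectType C) (a : gT -> 'End(X)) (Z : {vspace X}) :
    {vspace {ffun subg_of G -> X}} :=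
  vspace_of (fun f : {ffun subg_of G -> X} => (forall g, f g \in Z) /\
    (forall g, {in H, forall h, f (g * subg G h)%g = a h^-1%g (f g)})).

Lemma indP (X : vectType C) (a : gT -> 'End(X)) (Z : {vspace X}) f :
  f \in ind a Z <-> (forall g, f g \in Z) /\
    (forall g, {in H, forall h, f (g * subg G h)%g = a h^-1%g (f g)}).
Proof.
apply: vspace_ofP => [|c f1 f2 [f1Z af1] [f2Z af2]].
  by split=> g; [rewrite ffunE mem0v | move=> h _; rewrite !ffunE linear0].
split=> g; first by rewrite !ffunE memvD ?memvZ.
by move=> h Hh; rewrite !ffunE linearP /= af1 // af2.
Qed.

Section Dot.
Variables (V : vectType C) (dV : {dot V for conjC}).

Definition ind_dot (f1 f2 : {ffun subg_of G -> V}) : C :=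
  (#|H|%:R)^-1 * \sum_(g : subg_of G) dV (f1 g) (f2 g).

Fact ind_dot_bilinear : bilinear_for
  (GRing.Scale.Law.clone _ _ *%R _) (GRing.Scale.Law.clone _ _ (conjC \; *%R) _)
  ind_dot.
Proof.
split=> [f2|f1] c u v; rewrite /ind_dot /= mulrCA -mulrDr; congr (_ * _);
  rewrite mulr_sumr -big_split /=; apply: eq_bigr => g _; rewrite !ffunE.
  by rewrite linearPl.
by rewrite linearPr.
Qed.
HB.instance Definition _ :=
  bilinear_isBilinear.Build C _ _ _ _ _ ind_dot ind_dot_bilinear.

Fact ind_dot_hermitian u v :
  ind_dot u v = (-1) ^+ false * conjC (ind_dot v u).
Proof.
rewrite expr0 mul1r /ind_dot rmorphM fmorphV rmorph_nat rmorph_sum /=.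
congr (_ * _); apply: eq_bigr => g _.
by rewrite (@hermitian_subproof _ _ _ _ dV) expr0 mul1r.
Qed.
HB.instance Definition _ :=
  isHermitianSesquilinear.Build C _ _ _ ind_dot ind_dot_hermitian.

Fact ind_dot_gt0 u : u != 0 -> 0 < ind_dot u u.
Proof.
move=> nz_u; rewrite mulr_gt0 ?invr_gt0 ?ltr0n ?cardG_gt0 //.
have /existsP[g nz_ug] : [exists g, u g != 0].
  apply: contraR nz_u; rewrite negb_exists => /forallP u0.
  by apply/eqP/ffunP=> g; rewrite ffunE; apply/eqP; rewrite -[_ == _]negbK.
by rewrite (bigD1 g) //= ltr_pwDl ?neq0_dnorm_gt0 // sumr_ge0.
Qed.
HB.instance Definition _ := isDotProduct.Build C _ ind_dot ind_dot_gt0.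

End Dot.

(* L^\vee, for L in Hom_H(Res W, V). *)
Definition check_op (W : urep C G) (V : vectType C) (L : 'Hom(W, V)) :
    'Hom(W, {ffun subg_of G -> V}) :=
  linfun (fun w : W => [ffun g : subg_of G =>
    (sqrtC (#|G : H|%g%:R))^-1 *: L (ract W (val g)^-1%g w)]).

Lemma check_opE (W : urep C G) (V : vectType C) (L : 'Hom(W, V)) w g :
  check_op L w g =
    (sqrtC (#|G : H|%g%:R))^-1 *: L (ract W (val g)^-1%g w).
Proof.
rewrite linfunE ?ffunE // => c u v; apply/ffunP=> y.
by rewrite !ffunE !linearP /= !scalerA mulrC.
Qed.

End Ind.

Definition ffun_map (I : finType) (X Y : vectType C) (phi : 'Hom(X, Y)) :
    'Hom({ffun I -> X}, {ffun I -> Y}) :=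
  linfun (fun F : {ffun I -> X} => [ffun i => phi (F i)]).

Lemma ffun_mapE (I : finType) (X Y : vectType C) (phi : 'Hom(X, Y)) (F : {ffun I -> X}) i :
  ffun_map I phi F i = phi (F i).
Proof.
rewrite linfunE ?ffunE // => c u v.
by apply/ffunP=> y; rewrite !ffunE !linearP.
Qed.

(* The identification of Ind_H^G (Ind_K^H V) with Ind_K^G V: F corresponds to
   f g = F(g, 1). *)
Definition transit (G H : {group gT}) (V : vectType C) :
    'Hom({ffun subg_of G -> {ffun subg_of H -> V}}, {ffun subg_of G -> V}) :=
  linfun (fun F : {ffun subg_of G -> {ffun subg_of H -> V}} =>
            [ffun g => F g 1%g]).

Lemma transitE (G H : {group gT}) (V : vectType C) F g : transit G H V F g = F g 1%g.
Proof.
rewrite linfunE ?ffunE // => c u v.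
by apply/ffunP=> y; rewrite !ffunE.
Qed.

(* The identification of V with Ind_H^H V. *)
Definition ind_self (H : {group gT}) (V : urep C H) :
    'Hom(V, {ffun subg_of H -> V}) :=
  linfun (fun v : V => [ffun h : subg_of H => ract V (val h)^-1%g v]).

Lemma ind_selfE (H : {group gT}) (V : urep C H) v h : ind_self V v h = ract V (val h)^-1%g v.
Proof.
rewrite linfunE ?ffunE // => c u w.
by apply/ffunP=> y; rewrite !ffunE !linearP.
Qed.

(* The groups of the chain are numbered from 0: K = H 0 and G = H n, where n is
   the number of steps of the chain.  rho l enumerates the irreducible
   representations of H l, and theta = rho 0 t. *)
Section GelfandTsetlin.
Variables (H : nat -> {group gT}) (I : nat -> finType).
Variable rho : forall l, I l -> urep C (H l).
Arguments rho {l} _.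
Variable t : I 0%N.

(* The multiplicity of rho (l + 1) j in the representation induced from
   rho l i. *)
Definition ind_mult l (i : I l) (j : I l.+1) : nat :=
  multiplicity (rho j) (ind_act (H l.+1) (rho i))
    (ind (H l.+1) (H l) (ract (rho i)) fullv).

Fixpoint gtJ l : pred (I l) :=
  match l with
  | 0 => pred1 t
  | l'.+1 => [pred j | [exists i, gtJ i && (0 < ind_mult i j)%N]]
  end.

Definition gelfand_tsetlin (n : nat) : Prop :=
  forall l (i : I l) (j : I l.+1),
    (l < n)%N -> gtJ i -> gtJ j -> (ind_mult i j <= 1)%N.

(* Sequences (i_0, ..., i_l), as left-nested pairs. *)
Fixpoint gtseq l : finType :=
  match l with
  | 0 => I 0%N
  | l'.+1 => (gtseq l' * I l'.+1)%type : finType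
  end.

Definition gtend l : gtseq l -> I l :=
  match l with
  | 0 => fun c => c
  | l'.+1 => fun c => c.2
  end.

Fixpoint is_gtpath l : pred (gtseq l) :=
  match l return pred (gtseq l) with
  | 0 => fun c => gtJ (c : I 0%N)
  | l'.+1 => fun c =>
      [&& is_gtpath c.1, gtJ c.2 & ind_mult (gtend c.1) c.2 == 1%N]
  end.

Definition gtpaths n (s : I n) : pred (gtseq n) :=
  [pred c | is_gtpath c && (gtend c == s)].

(* From a subspace M of W affording the last term of c, go down along c to a
   subspace affording its first term. *)
Fixpoint restr_along (W : vectType C) (a : gT -> 'End(W)) l :
    gtseq l -> {vspace W} -> {vspace W} :=
  match l with
  | 0 => fun _ M => M
  | l'.+1 => fun c M => restr_along a c.1
      (the_vspace (fun M' : {vspace W} =>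
         (M' <= M)%VS /\ affords (rho (gtend c.1)) a M'))
  end.

(* The subspace V_C of W. *)
Definition restr_space n (s : I n) (c : gtseq n) : {vspace rho s} :=
  restr_along (ract (rho s)) c fullv.

(* L is (a choice of) L_{sigma,C}. *)
Definition path_isometry n (s : I n) (c : gtseq n)
    (L : 'Hom(rho t, rho s)) : Prop :=
  [/\ L \in HomG (rho t) (ract (rho s)) fullv,
      forall u v, rdot (rho s) (L u) (L v) = rdot (rho t) u v &
      limg L = restr_space s c].

(* The ambient space of Ind_{H (l-1)}^{H l} ... Ind_{H 0}^{H 1} V: the functions
   on H l with values in the functions on H (l-1) with values in ... V. *)
Fixpoint iter_space l : vectType C :=
  match l with
  | 0 => rho t
  | l'.+1 => {ffun subg_of (H l'.+1) -> iter_space l'} : vectType C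
  end.

Definition iter_act l : gT -> 'End(iter_space l) :=
  match l with
  | 0 => ract (rho t)
  | l'.+1 => ind_act (H l'.+1) (iter_space l')
  end.

(* The subspaces Z_l of the iterated induced representations. *)
Fixpoint iter_sub l : gtseq l -> {vspace iter_space l} :=
  match l with
  | 0 => fun _ => fullv
  | l'.+1 => fun c =>
      the_vspace (fun M : {vspace iter_space l'.+1} =>
        (M <= ind (H l'.+1) (H l') (@iter_act l') (iter_sub c.1))%VS /\
        affords (rho c.2) (@iter_act l'.+1) M)
  end.

(* Transitivity of induction, from the iterated induced representation to
   Ind_{H 0}^{H l} V.  At l = 1 this is the identity (on the induced
   representation). *)
Fixpoint iter_transit l :
    'Hom(iter_space l, {ffun subg_of (H l) -> rho t}) :=
  match l with
  | 0 => ind_self (rho t)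
  | l'.+1 => (transit (H l'.+1) (H l') (rho t) \o
              ffun_map (subg_of (H l'.+1)) (iter_transit l'))%VF
  end.

(* The subspace W_C of Ind_K^G V. *)
Definition ind_path_space n (c : gtseq n) :
    {vspace {ffun subg_of (H n) -> rho t}} :=
  (iter_transit n @: iter_sub c)%VS.

(* Ind_K^G V *)
Definition gt_ind n : {vspace {ffun subg_of (H n) -> rho t}} :=
  ind (H n) (H 0%N) (ract (rho t)) fullv.

Definition gt_dot n : {dot {ffun subg_of (H n) -> rho t} for conjC} :=
  ind_dot (H 0%N) (rdot (rho t)).

(* sqrt (d_sigma / d_theta) (L^* )^\vee *)
Definition path_op n (s : I n) (L : 'Hom(rho t, rho s)) :
    'Hom(rho s, {ffun subg_of (H n) -> rho t}) :=
  sqrtC ((\dim {:rho s})%:R / (\dim {:rho t})%:R) *: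
    check_op (H 0%N) (adjoint (rdot (rho t)) (rdot (rho s)) L).

End GelfandTsetlin.

End Rep.

(* Main.v *)
(* For a path C ending at rho_j, compose the (unique up to scalars) embeddings
   rho_l -> Res rho_(l+1) along C into Lambda_C : V -> rho_j.  By induction, the
   restriction of rho_j along C ends with the image of Lambda_C, while the
   subspace Z_(l+1) of the iterated induced representation is the image of a map
   S_C such that S_C w, evaluated at 1 in all variables, is a multiple of
   Lambda_C^* w.  Hence the image of S_C in Ind_K^G V is that of
   (Lambda_C^* )^\vee, and L_(sigma,C) is a multiple of Lambda_C by Schur's lemma.
   Orthonormality follows by averaging L_C' L_C^* over G and taking traces.  For
   the generation of Hom_G(W, Ind_K^G V), write an element as B^\vee: then
   B L_C is a scalar b_C, and B - sum_C b_C L_C^* vanishes on all the V_C, which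
   span the theta-isotypic component of W. *)

Require Import Defs.
Set Warnings "-notation-overridden,-ambiguous-paths,-redundant-canonical-projection".
From HB Require Import structures.
From mathcomp Require Import all_boot all_order all_fingroup all_algebra.
From mathcomp Require Import sesquilinear spectral complex.
From mathcomp Require Import boolp classical_sets reals.

Set Implicit Arguments.
Unset Strict Implicit.
Unset Printing Implicit Defensive.

Import GRing.Theory Num.Theory Num.Def.
Import passmx.
Local Open Scope ring_scope.

(* mathcomp.fingroup.action also defines a constant ract. *)
Local Notation ract := Defs.ract.

(** * Linear algebra *)

Lemma the_vspace_unique (C : fieldType) (X : vectType C)
    (P : {vspace X} -> Prop) U :
  P U -> (forall U', P U' -> U' = U) -> the_vspace P = U.
Proof. exact: xget_unique. Qed.

Section Trace.
Variables (C : fieldType) (X Y : vectType C).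

Lemma lftraceC (f : 'Hom(X, Y)) (g : 'Hom(Y, X)) :
  lftrace (f \o g)%VF = lftrace (g \o f)%VF.
Proof. by rewrite /lftrace !(mxof_comp _ _ (vbasisP _)) mxtrace_mulC. Qed.

Lemma lftraceZ a (f : 'End(X)) : lftrace (a *: f) = a * lftrace f.
Proof. by rewrite /lftrace linearZ mxtraceZ. Qed.

Lemma lftrace_sum I (r : seq I) (P : pred I) (F : I -> 'End(X)) :
  lftrace (\sum_(i <- r | P i) F i) = \sum_(i <- r | P i) lftrace (F i).
Proof. by rewrite /lftrace linear_sum raddf_sum. Qed.

Lemma lftrace_scalar a : lftrace (a *: \1%VF : 'End(X)) = a *+ \dim {:X}.
Proof.
by rewrite lftraceZ /lftrace mxof1 ?mxtrace1 ?mulr_natr ?(basis_free (vbasisP _)).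
Qed.

End Trace.

Lemma lfun_eigenvector (C : numClosedFieldType) (X : vectType C) (T : 'End(X)) :
  {:X}%VS != 0%VS -> exists (a : C) (v : X), v != 0 /\ T v = a *: v.
Proof.
rewrite -dimv_eq0 -lt0n => X_gt0; set e := vbasis {:X}.
have [a] := eigenvalue_closed (mxof e e T) X_gt0.
rewrite /eigenvalue -(vsof_eq0 (vbasisP _)) -leigenspaceE ?vbasisP //.
rewrite -vpick0 => nz_v; exists a, (vpick (leigenspace T a)); split=> //.
have := memv_pick (leigenspace T a).
by rewrite memv_ker add_lfunE opp_lfunE scale_lfunE id_lfunE subr_eq0 => /eqP.
Qed.

Section Dot.
Variables (C : numClosedFieldType) (X : vectType C) (d : {dot X for conjC}).

Lemma dotC u v : d u v = (d v u)^*.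
Proof. by rewrite (@hermitian_subproof _ _ _ _ d) expr0 mul1r. Qed.

Lemma dotDl u v w : d (u + v) w = d u w + d v w.
Proof. exact: linearDl. Qed.

Lemma dotDr u v w : d u (v + w) = d u v + d u w.
Proof. exact: linearDr. Qed.

Lemma dot0l u : d 0 u = 0.
Proof. exact: linear0l. Qed.

Lemma dot0r u : d u 0 = 0.
Proof. exact: linear0r. Qed.

Lemma dot_suml I (r : seq I) (P : pred I) (F : I -> X) v :
  d (\sum_(i <- r | P i) F i) v = \sum_(i <- r | P i) d (F i) v.
Proof. exact: linear_sumlz. Qed.

Lemma dotZl a u v : d (a *: u) v = a * d u v.
Proof. exact: linearZl_LR. Qed.

Lemma dotZr a u v : d u (a *: v) = a^* * d u v.
Proof. exact: linearZr_LR. Qed.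

Lemma dot_inj u v : (forall w, d w u = d w v) -> u = v.
Proof.
move=> /(_ (u - v))/eqP; rewrite -subr_eq0 -linearBr dnorm_eq0 subr_eq0.
by move/eqP.
Qed.

(** Sending y to the row of the products [d y e_i] is linear and injective, hence onto by dimension.
    So these products can be prescribed on a basis. *)
Lemma riesz (phi : X -> C) : scalar phi -> exists y, forall x, d x y = phi x.
Proof.
move=> phiL; pose e := vbasis {:X}; pose n := \dim {:X}.
have [fL fE] : {f : 'Hom(X, 'rV[C]_n) | forall y, f y = \row_i d y e`_i}.
  exists (linfun (fun y => \row_i d y e`_i)) => y; rewrite linfunE // => a u v.
  by apply/rowP=> i; rewrite !mxE dotDl dotZl.
pose pL := GRing.isLinear.Build _ _ _ _ phi phiL.
pose phi' : {scalar X} := HB.pack phi pL.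
(* Used twice: with v = 0 for the injectivity of [fL], and with v = 1 for the final identity. *)
have dot_basis u v : (forall i : 'I_n, d e`_i u = phi' e`_i * v) ->
    forall x, d x u = phi' x * v.
  move=> dE x; rewrite (coord_vbasis (memvf x)) dot_suml linear_sum mulr_suml.
  by apply: eq_bigr => i _; rewrite dotZl linearZ /= dE mulrA.
have kerf : lker fL = 0%VS.
  apply/eqP; rewrite -subv0; apply/subvP=> y; rewrite memv_ker memv0 fE => /eqP y0.
  rewrite -(dnorm_eq0 d) (dot_basis y 0) ?mulr0 // => i; rewrite mulr0.
  by move/rowP/(_ i): y0; rewrite !mxE [d e`_i y]dotC => ->; rewrite conjC0.
(* The conjugates appear because [fL] has y in the first, linear argument, while the goal has it in
   the second. *)
have /memv_imgP[y _ fy] : \row_i (phi e`_i)^* \in limg fL.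
  suff -> : limg fL = fullv by rewrite memvf.
  apply/eqP; rewrite eqEdim subvf limg_dim_eq ?kerf ?capv0 //.
  by rewrite dimvf /dim /= mul1n.
exists y => x; rewrite (dot_basis y 1) ?mulr1 // => i.
by move/rowP/(_ i): fy; rewrite fE !mxE mulr1 [d e`_i y]dotC => <-; rewrite conjCK.
Qed.

End Dot.

Section Adjoint.
Variables (C : numClosedFieldType) (X Y : vectType C).
Variables (dX : {dot X for conjC}) (dY : {dot Y for conjC}).

(** [riesz] gives the adjoint pointwise, and non-degeneracy makes the chosen values linear. Hence
    the description defining [adjoint] never takes its default value. *)
Lemma adjointE (T : 'Hom(X, Y)) x y : dY (T x) y = dX x (adjoint dX dY T y).
Proof.
suff : exists S : 'Hom(Y, X), forall x y, dY (T x) y = dX x (S y).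
  by move/xgetPex => /(_ 0); apply.
have /choice[S ST] y' : exists z, forall x', dX x' z = dY (T x') y'.
  by apply: riesz => a u v; rewrite linearP /= dotDl dotZl.
exists (linfun S) => x' y'; rewrite linfunE ?ST // => a u v.
by apply: (dot_inj (d := dX)) => w; rewrite dotDr dotZr !ST dotDr dotZr.
Qed.

Lemma adjointEr (T : 'Hom(X, Y)) x y : dY y (T x) = dX (adjoint dX dY T y) x.
Proof. by rewrite dotC adjointE -dotC. Qed.

Lemma adjoint_unique (T : 'Hom(X, Y)) (S : 'Hom(Y, X)) :
  (forall x y, dY (T x) y = dX x (S y)) -> adjoint dX dY T = S.
Proof.
by move=> ST; apply/lfunP=> y; apply: (dot_inj (d := dX)) => x; rewrite -adjointE ST.
Qed.

Lemma adjointZ a T : adjoint dX dY (a *: T) = a^* *: adjoint dX dY T.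
Proof.
apply: adjoint_unique => x y.
by rewrite !scale_lfunE dotZl dotZr conjCK adjointE.
Qed.

End Adjoint.

Section AdjointComp.
Variables (C : numClosedFieldType) (X Y Z : vectType C).
Variables (dX : {dot X for conjC}) (dY : {dot Y for conjC}) (dZ : {dot Z for conjC}).

Lemma adjointK (T : 'Hom(X, Y)) : adjoint dY dX (adjoint dX dY T) = T.
Proof. by apply: adjoint_unique => x y; rewrite -adjointEr. Qed.

Lemma adjoint_comp (T : 'Hom(X, Y)) (S : 'Hom(Y, Z)) :
  adjoint dX dZ (S \o T)%VF = (adjoint dX dY T \o adjoint dY dZ S)%VF.
Proof. by apply: adjoint_unique => x y; rewrite !comp_lfunE /= (adjointE dY) (adjointE dX). Qed.

Lemma adjoint_eq0 (T : 'Hom(X, Y)) : (adjoint dX dY T == 0) = (T == 0).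
Proof.
have adj0 (U V : vectType C) (dU : {dot U for conjC}) (dV : {dot V for conjC}) :
    adjoint dU dV 0 = 0.
  by apply: adjoint_unique => x y; rewrite !lfunE /= dot0l dot0r.
by apply/eqP/eqP=> [/(congr1 (adjoint dY dX))|->]; rewrite ?adjointK adj0.
Qed.

End AdjointComp.

(** * Equivariant maps and Schur's lemma *)

Lemma limgZ (C : fieldType) (X Y : vectType C) (a : C) (f : 'Hom(X, Y)) :
  a != 0 -> limg (a *: f) = limg f.
Proof.
move=> nz_a; apply/eqP; rewrite eqEsubv; apply/andP; split; apply/subvP=> _ /memv_imgP[v _ ->].
  by rewrite scale_lfunE -linearZ memv_img ?memvf.
have -> : f v = (a *: f) (a^-1 *: v) by rewrite scale_lfunE linearZ scalerA divff ?scale1r.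
by rewrite memv_img ?memvf.
Qed.

Lemma lker0_comp (C : fieldType) (X Y Z : vectType C) (f : 'Hom(Y, Z))
    (g : 'Hom(X, Y)) :
  lker f == 0%VS -> lker g == 0%VS -> lker (f \o g)%VF == 0%VS.
Proof.
move=> kf kg; apply/lker0P=> u v; rewrite !comp_lfunE /=.
by move/(lker0P kf)/(lker0P kg).
Qed.

Lemma lfun_neq0P (C : fieldType) (X Y : vectType C) (f : 'Hom(X, Y)) :
  reflect (exists v, f v != 0) (f != 0).
Proof.
apply: (iffP lfunPn) => -[v]; first by rewrite zero_lfunE; exists v.
by exists v; rewrite zero_lfunE.
Qed.

Section Equivariant.
Variables (C : numClosedFieldType) (gT : finGroupType).

(** Pointwise form of [intertwines]. The group is separate from the actions, so restricting to a
    subgroup changes G only. *)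
Definition equivariant (G : {group gT}) (X Y : vectType C) (a : gT -> 'End(X))
    (b : gT -> 'End(Y)) (T : 'Hom(X, Y)) : Prop :=
  {in G, forall x v, T (a x v) = b x (T v)}.

Section Basics.
Variables (G : {group gT}) (X Y Z : vectType C) (a : gT -> 'End(X))
  (b : gT -> 'End(Y)) (c : gT -> 'End(Z)).

Lemma equivariant_comp (S : 'Hom(Y, Z)) (T : 'Hom(X, Y)) :
  equivariant G b c S -> equivariant G a b T -> equivariant G a c (S \o T)%VF.
Proof. by move=> bcS abT x Gx v; rewrite !comp_lfunE /= abT ?bcS. Qed.

Lemma equivariant_sub (K : {group gT}) (T : 'Hom(X, Y)) :
  K \subset G -> equivariant G a b T -> equivariant K a b T.
Proof. by move=> /fintype.subsetP KG abT x /KG; apply: abT. Qed.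

(** Pulls a map into the image of an embedding S back to the source of S, where Schur's lemma or
    multiplicity one applies. *)
Lemma equivariant_factor (S : 'Hom(Y, Z)) (T : 'Hom(X, Z)) :
    lker S == 0%VS -> (limg T <= limg S)%VS ->
    equivariant G b c S -> equivariant G a c T ->
  equivariant G a b (S^-1 \o T)%VF.
Proof.
move=> /lker0P injS /subvP sTS bcS acT x Gx v; apply: injS.
by rewrite bcS // !comp_lfunE /= !limg_lfunVK ?sTS ?memv_img ?memvf // acT.
Qed.

End Basics.

Lemma equivariant1 (G : {group gT}) (X : vectType C) (a : gT -> 'End(X)) :
  equivariant G a a \1%VF.
Proof. by move=> x Gx v; rewrite !id_lfunE. Qed.

Lemma intertwinesP (G : {group gT}) (W : urep C G) (X : vectType C)
    (a : gT -> 'End(X)) (T : 'Hom(W, X)) :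
  intertwines a T <-> equivariant G (ract W) a T.
Proof.
split=> aT x Gx; last by apply/lfunP=> v; rewrite !comp_lfunE /= aT.
by move=> v; move/lfunP/(_ v): (aT x Gx); rewrite !comp_lfunE.
Qed.

Section Action.
Variables (G : {group gT}) (W : urep C G).

Lemma ractMv x y v : x \in G -> y \in G ->
  ract W (x * y)%g v = ract W x (ract W y v).
Proof. by move=> Gx Gy; rewrite ractM // comp_lfunE. Qed.

Lemma ract1v v : ract W 1%g v = v.
Proof. by rewrite ract1 id_lfunE. Qed.

Lemma ractK x : x \in G -> cancel (ract W x) (ract W x^-1%g).
Proof. by move=> Gx v; rewrite -ractMv ?groupV // mulVg ract1v. Qed.

Lemma ractVK x : x \in G -> cancel (ract W x^-1%g) (ract W x).
Proof. by move=> Gx v; rewrite -ractMv ?groupV // mulgV ract1v. Qed.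

Lemma rdot_ractl x u v : x \in G ->
  rdot W (ract W x u) v = rdot W u (ract W x^-1%g v).
Proof. by move=> Gx; rewrite -{1}(ractVK Gx v) ract_unitary. Qed.

End Action.

(** By unitarity the adjoint of the action of x is that of its inverse. The three groups allow for
    maps between restrictions of representations of different groups of the chain. *)
Lemma adjoint_equivariant (G1 G2 K : {group gT}) (W1 : urep C G1)
    (W2 : urep C G2) (T : 'Hom(W1, W2)) :
    K \subset G1 -> K \subset G2 -> equivariant K (ract W1) (ract W2) T ->
  equivariant K (ract W2) (ract W1) (adjoint (rdot W1) (rdot W2) T).
Proof.
move=> /fintype.subsetP KG1 /fintype.subsetP KG2 KT x Kx v; apply: (dot_inj (d := rdot W1)) => u.
have KVx : x^-1%g \in K by rewrite groupV.
transitivity (rdot W1 (ract W1 x^-1%g u) (adjoint (rdot W1) (rdot W2) T v)).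
  by rewrite -!(adjointE (rdot W1)) KT // rdot_ractl ?KG2 ?invgK.
by rewrite rdot_ractl ?KG1 ?invgK.
Qed.

Lemma irreducible_neq0 (G : {group gT}) (W : urep C G) :
  irreducible W -> exists v : W, v != 0.
Proof. by case=> nzW _; exists (vpick {:W}%VS); rewrite vpick0. Qed.

Lemma dim_irr_neq0 (G : {group gT}) (W : urep C G) :
  irreducible W -> (\dim {:W})%:R != 0 :> C.
Proof. by case=> nzW _; rewrite pnatr_eq0 dimv_eq0. Qed.

Lemma schur_ker0 (G : {group gT}) (W : urep C G) (X : vectType C)
    (a : gT -> 'End(X)) (T : 'Hom(W, X)) :
  irreducible W -> equivariant G (ract W) a T -> T != 0 -> lker T == 0%VS.
Proof.
move=> [_ irrW] aT nzT; case: (irrW (lker T)) => [x Gx|->|kT] //.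
  apply/subvP=> _ /memv_imgP[v + ->]; rewrite !memv_ker => /eqP Tv.
  by rewrite aT // Tv linear0.
case/eqP: nzT; apply/lfunP=> v; apply/eqP; rewrite zero_lfunE -memv_ker kT.
exact: memvf.
Qed.

Lemma schur_limg (G : {group gT}) (W : urep C G) (X : vectType C)
    (a : gT -> 'End(X)) (T : 'Hom(X, W)) :
  irreducible W -> equivariant G a (ract W) T -> T != 0 -> limg T = fullv.
Proof.
move=> [_ irrW] aT nzT; case: (irrW (limg T)) => [x Gx|T0|//].
  apply/subvP=> _ /memv_imgP[_ /memv_imgP[u _ ->] ->].
  by rewrite -aT // memv_img ?memvf.
case/eqP: nzT; apply/lfunP=> v; apply/eqP; rewrite zero_lfunE -memv0 -T0.
by rewrite memv_img ?memvf.
Qed.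

(** If a is an eigenvalue of T, then T - a has a nonzero kernel, so it vanishes by [schur_ker0]. *)
Lemma schur_scalar (G : {group gT}) (W : urep C G) (T : 'End(W)) :
  irreducible W -> equivariant G (ract W) (ract W) T ->
  exists a, T = a *: \1%VF.
Proof.
move=> irrW GT; have [a [v [nz_v Tv]]] := lfun_eigenvector T (proj1 irrW).
exists a; apply/eqP; rewrite -subr_eq0; apply/negPn/negP => nzD.
have GD : equivariant G (ract W) (ract W) (T - a *: \1%VF).
  move=> x Gx u; rewrite !add_lfunE !opp_lfunE !scale_lfunE !id_lfunE GT //.
  by rewrite -[a *: ract W x u]linearZ -linearB.
have /eqP ker0 := schur_ker0 irrW GD nzD.
case/negP: nz_v; rewrite -memv0 -ker0 memv_ker.
by rewrite !add_lfunE !opp_lfunE !scale_lfunE !id_lfunE Tv subrr.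
Qed.

Lemma schur_equivalent (G : {group gT}) (W1 W2 : urep C G) (T : 'Hom(W1, W2)) :
  irreducible W1 -> irreducible W2 -> equivariant G (ract W1) (ract W2) T ->
  T != 0 -> equivalent W1 W2.
Proof.
move=> irr1 irr2 GT nzT; exists T; split; first exact/intertwinesP.
  exact: schur_ker0 irr1 GT nzT.
exact: schur_limg irr2 GT nzT.
Qed.

Lemma affordsP (G : {group gT}) (W : urep C G) (X : vectType C)
    (a : gT -> 'End(X)) (U : {vspace X}) :
  affords W a U <->
  exists T : 'Hom(W, X), [/\ equivariant G (ract W) a T, lker T == 0%VS & limg T = U].
Proof. by split=> -[T [aT kT imT]]; exists T; split=> //; apply/intertwinesP. Qed.

Section Subrep.
Variables (G : {group gT}) (W : urep C G) (M : {vspace W}).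
Hypothesis M_stable : {in G, forall x, (ract W x @: M <= M)%VS}.

Definition sub_dot (u v : subvs_of M) : C := rdot W (vsval u) (vsval v).

Fact sub_dot_bilinear : bilinear_for
  (GRing.Scale.Law.clone _ _ *%R _) (GRing.Scale.Law.clone _ _ (conjC \; *%R) _)
  sub_dot.
Proof. by split=> [v|u] a x y; [exact: linearPl | exact: linearPr]. Qed.
HB.instance Definition _ :=
  bilinear_isBilinear.Build C _ _ _ _ _ sub_dot sub_dot_bilinear.

Fact sub_dot_hermitian u v : sub_dot u v = (-1) ^+ false * conjC (sub_dot v u).
Proof. by rewrite expr0 mul1r -dotC. Qed.
HB.instance Definition _ :=
  isHermitianSesquilinear.Build C _ _ _ sub_dot sub_dot_hermitian.

Fact sub_dot_gt0 u : u != 0 -> 0 < sub_dot u u.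
Proof. by move=> nz_u; rewrite dnorm_gt0. Qed.
HB.instance Definition _ := isDotProduct.Build C _ sub_dot sub_dot_gt0.

Definition sub_act (x : gT) : 'End(subvs_of M) :=
  linfun (fun u => vsproj M (ract W x (vsval u))).

Lemma sub_actE x u : x \in G -> vsval (sub_act x u) = ract W x (vsval u).
Proof.
move=> Gx; rewrite /sub_act linfunE => [|k v w]; last by rewrite !linearP.
by rewrite vsprojK // (subvP (M_stable Gx)) // memv_img ?subvsP.
Qed.

Fact sub_act1 : sub_act 1%g = \1%VF.
Proof. by apply/lfunP=> u; apply/val_inj; rewrite /= sub_actE // ract1v id_lfunE. Qed.

Fact sub_actM : {in G &, forall x y, sub_act (x * y)%g = (sub_act x \o sub_act y)%VF}.
Proof.
move=> x y Gx Gy; apply/lfunP=> u; apply/val_inj => /=.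
by rewrite comp_lfunE !sub_actE ?groupM // ractMv.
Qed.

Fact sub_act_unitary : {in G, forall x u v,
  sub_dot (sub_act x u) (sub_act x v) = sub_dot u v}.
Proof. by move=> x Gx u v; rewrite /sub_dot !sub_actE // ract_unitary. Qed.

(** [irreducible] and [complete_irr] speak of [urep] only, so a stable subspace has to be turned
    into one before they apply. *)
Definition subrep : urep C G := @URep C gT G (subvs_of M) sub_dot sub_act
  sub_act1 sub_actM sub_act_unitary.

End Subrep.

End Equivariant.

(** * Complete reducibility and Frobenius reciprocity *)

Section Reducibility.
Variables (C : numClosedFieldType) (gT : finGroupType).

(** Induction on the dimension: if M is not irreducible, it has a proper nonzero stable subspace, to
    which the induction hypothesis applies. *)
Lemma exists_irreducible_sub (G : {group gT}) (W : urep C G) (M : {vspace W}) :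
    {in G, forall x, (ract W x @: M <= M)%VS} -> M != 0%VS ->
  exists (U : urep C G) (T : 'Hom(U, W)),
    [/\ irreducible U, equivariant G (ract U) (ract W) T, T != 0 & (limg T <= M)%VS].
Proof.
have [k] := ubnP (\dim M); elim: k M => // k IHk M /ltnSE leMk GM nzM.
have incE u : linfun (vsval : subvs_of M -> W) u = vsval u by rewrite linfunE.
case: (pselect (irreducible (subrep GM))) => [irrM|].
  exists (subrep GM), (linfun (vsval : subvs_of M -> W)); split=> //.
  - by move=> x Gx u; rewrite !incE sub_actE.
  - apply/lfun_neq0P; exists (vsproj M (vpick M)).
    by rewrite incE vsprojK ?memv_pick // vpick0.
  - by apply/subvP=> _ /memv_imgP[u _ ->]; rewrite incE subvsP.
move/not_andP=> [/negP/negPn/eqP M0|].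
  have : vsproj M (vpick M) \in {:subvs_of M}%VS by exact: memvf.
  rewrite M0 memv0 => /eqP/(congr1 (@vsval _ _ _)); rewrite vsprojK ?memv_pick //.
  by move/eqP; rewrite vpick0 (negPf nzM).
move/existsNP=> [N /not_implyP[GN /not_orP[/eqP nzN /eqP neqN]]].
pose inc := linfun (vsval : subvs_of M -> W).
have kinc : lker inc == 0%VS.
  by apply/lker0P=> u v; rewrite !incE; apply: subvs_inj.
have dimN : \dim (inc @: N) = \dim N.
  by rewrite limg_dim_eq // (eqP kinc) capv0.
case: (IHk (inc @: N)%VS).
- rewrite dimN (leq_trans _ leMk) // ltnNge; apply: contra neqN => leMN.
  by rewrite eqEdim subvf dimvf.
- move=> x Gx; apply/subvP=> _ /memv_imgP[_ /memv_imgP[u Nu ->] ->].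
  rewrite incE -(sub_actE GM) // -incE memv_img //.
  by apply: (subvP (GN x Gx)); rewrite memv_img.
- by rewrite -dimv_eq0 dimN dimv_eq0.
move=> U [T [irrU GT nzT imT]]; exists U, T; split=> //.
apply: subv_trans imT _; apply/subvP=> _ /memv_imgP[u _ ->].
by rewrite incE subvsP.
Qed.

(* The vectors orthogonal to all the images of the representations rho i form
   a stable subspace, which contains no irreducible subspace. *)
Lemma exists_adjoint_neq0 (G K : {group gT}) (W : urep C G) (I : finType)
    (rho : I -> urep C K) (w : W) :
    K \subset G -> complete_irr rho -> w != 0 ->
  exists i (T : 'Hom(rho i, W)), equivariant K (ract (rho i)) (ract W) T /\
    adjoint (rdot (rho i)) (rdot W) T w != 0.
Proof.
move=> sKG [irr_rho _ rho_all]; apply: contraPP => no_T; apply/negP/negPn.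
pose resW := @URep C gT K W (rdot W) (ract W) (ract1 W)
  (sub_in2 (fintype.subsetP sKG) (@ractM _ _ _ W))
  (sub_in1 (fintype.subsetP sKG) (@ract_unitary _ _ _ W)).
pose killed v := forall i (T : 'Hom(rho i, W)),
  equivariant K (ract (rho i)) (ract W) T -> adjoint (rdot (rho i)) (rdot W) T v = 0.
pose N : {vspace resW} := vspace_of killed.
have NP v : v \in N <-> killed v.
  apply: vspace_ofP => [i T _|a u v' uN vN i T KT]; first by rewrite linear0.
  by rewrite linearP /= uN // vN // scaler0 addr0.
have wN : w \in N.
  apply/NP => i T KT; apply/eqP/negPn/negP => nzTw.
  by apply: no_T; exists i, T.
case: (eqVneq N 0%VS) wN => [->|nzN _]; first by rewrite memv0.
have KN : {in K, forall x, (ract resW x @: N <= N)%VS}.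
  move=> x Kx; apply/subvP=> _ /memv_imgP[v /NP vN ->]; apply/NP => i T KT.
  by rewrite (adjoint_equivariant (subxx K) sKG KT) // vN ?linear0.
have [U [T [irrU KT nzT imT]]] := exists_irreducible_sub KN nzN.
have [i [S [/intertwinesP KS kS imS]]] := rho_all U irrU.
have KT' : equivariant K (ract (rho i)) (ract W) (T \o S^-1)%VF.
  apply: (equivariant_comp KT) => x Kx v.
  have /memv_imgP[u _ ->] : v \in limg S by rewrite imS memvf.
  by rewrite -KS // !lker0_lfunK.
have [v nzv] : exists v, (T \o S^-1)%VF v != 0.
  have /lfun_neq0P[u nzu] := nzT; exists (S u).
  by rewrite comp_lfunE /= lker0_lfunK.
have /NP/(_ _ _ KT') : (T \o S^-1)%VF v \in N.
  by rewrite comp_lfunE /= (subvP imT) // memv_img ?memvf.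
move/(congr1 (rdot (rho i) v)); rewrite -adjointE dot0r => /eqP.
by rewrite dnorm_eq0 (negPf nzv).
Qed.

End Reducibility.

Section Frobenius.
Variables (C : numClosedFieldType) (gT : finGroupType).
Variables (G K : {group gT}) (W : urep C G) (V : urep C K).
Hypothesis sKG : K \subset G.

Let c := sqrtC (#|G : K|%g%:R : C).

Fact index_sqrt_neq0 : c != 0.
Proof. by rewrite sqrtC_eq0 pnatr_eq0 -lt0n indexg_gt0. Qed.

Fact check_op_is_linear : linear (@check_op C gT G K W V).
Proof.
move=> a L1 L2; apply/lfunP=> w; apply/ffunP=> g.
rewrite add_lfunE scale_lfunE !ffunE !check_opE add_lfunE scale_lfunE.
by rewrite scalerDr !scalerA mulrC.
Qed.
HB.instance Definition _ := GRing.isLinear.Build _ _ _ _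
  (@check_op C gT G K W V) check_op_is_linear.

Lemma check_op_inj : injective (@check_op C gT G K W V).
Proof.
move=> L1 L2 eqL; apply/lfunP=> w.
move/lfunP/(_ w)/ffunP/(_ 1%g): eqL; rewrite !check_opE /= invg1 ract1v.
by apply: scalerI; rewrite invr_eq0 index_sqrt_neq0.
Qed.

Lemma check_op_HomG (L : 'Hom(W, V)) :
  equivariant K (ract W) (ract V) L ->
  check_op K L \in HomG W (ind_act G V) (ind G K (ract V) fullv).
Proof.
move=> KL; apply/HomGP; split=> [w|].
  apply/indP; split=> [g|g h Kh]; first exact: memvf.
  have Gh := fintype.subsetP sKG h Kh.
  rewrite !check_opE linearZ /= -KL ?groupV //; congr (_ *: L _).
  by rewrite -ractMv ?groupV ?subgP // subgK // invMg.
apply/intertwinesP => x Gx w; apply/ffunP=> g.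
rewrite ind_actE !check_opE; congr (_ *: L _).
by rewrite -ractMv ?groupV ?subgP //= subgK // invMg invgK.
Qed.

(** An equivariant map into a space of functions on G is determined by its values at 1. *)
Lemma HomG_eval (X : vectType C) (T : 'Hom(W, {ffun subg_of G -> X})) w g :
  equivariant G (ract W) (ind_act G X) T ->
  T w g = T (ract W (val g)^-1%g w) 1%g.
Proof.
move=> GT; rewrite GT ?groupV ?subgP // ind_actE mulg1; congr (T w _).
by apply/val_inj; rewrite /= subgK ?groupV ?subgP // invgK.
Qed.

(** Surjectivity in Frobenius reciprocity: L is evaluation at 1, and the factor c cancels the
    normalisation of [check_op]. L commutes with K because, at 1, left translation and the
    covariance of induced functions coincide. *)
Lemma HomG_check_op (T : 'Hom(W, {ffun subg_of G -> V})) :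
  T \in HomG W (ind_act G V) (ind G K (ract V) fullv) ->
  exists2 L, equivariant K (ract W) (ract V) L & T = check_op K L.
Proof.
move/HomGP=> [imT /intertwinesP GT].
have LE w : linfun (fun w => c *: T w 1%g) w = c *: T w 1%g.
  by rewrite linfunE // => a u v; rewrite linearP !ffunE scalerDr !scalerA mulrC.
exists (linfun (fun w => c *: T w 1%g)).
  move=> h Kh w; rewrite !LE linearZ /=; congr (_ *: _).
  have Gh := fintype.subsetP sKG h Kh.
  have /indP[_ indT] := imT w.
  rewrite GT // ind_actE mulg1 -[in RHS](invgK h) -indT ?groupV // mul1g.
  by congr (T w _); apply/val_inj; rewrite /= !subgK ?groupV.
apply/lfunP=> w; apply/ffunP=> g; rewrite check_opE LE scalerA mulVf ?index_sqrt_neq0 //.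
by rewrite scale1r HomG_eval.
Qed.

Let mult := multiplicity W (ind_act G V) (ind G K (ract V) fullv).

Lemma multiplicity_gt0 (T : 'Hom(V, W)) :
  equivariant K (ract V) (ract W) T -> T != 0 -> (0 < mult)%N.
Proof.
move=> KT nzT; rewrite lt0n dimv_eq0; apply/negP => /eqP Hom0.
have := check_op_HomG (adjoint_equivariant (subxx K) sKG KT).
rewrite Hom0 memv0 -(linear0 (@check_op C gT G K W V)) (inj_eq check_op_inj) adjoint_eq0.
exact/negP.
Qed.

(** Frobenius reciprocity followed by the adjoint is an antilinear bijection from Hom_G(W, Ind V) to
    Hom_K(V, Res W). So the latter is a line too, and T0 comes from a generator of the former. *)
Lemma multiplicity_one : mult = 1%N ->
  exists T0 : 'Hom(V, W), [/\ T0 != 0, equivariant K (ract V) (ract W) T0 &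
    forall T, equivariant K (ract V) (ract W) T -> exists a, T = a *: T0].
Proof.
rewrite /mult /multiplicity => dim1.
set HG := HomG _ _ _ in dim1.
have [L KL L0] := HomG_check_op (memv_pick HG).
have lineHG : HG = <[check_op K L]>%VS.
  apply/esym/eqP; rewrite eqEdim -memvE -L0 memv_pick dim1 dim_vline.
  by rewrite vpick0 -dimv_eq0 dim1.
have nzL : L != 0.
  by rewrite -(inj_eq check_op_inj) linear0 -L0 vpick0 -dimv_eq0 dim1.
exists (adjoint (rdot W) (rdot V) L); split; first by rewrite adjoint_eq0.
  exact: (adjoint_equivariant sKG (subxx K) KL).
move=> T KT; have := check_op_HomG (adjoint_equivariant (subxx K) sKG KT).
rewrite -/HG lineHG => /vlineP[a]; rewrite -linearZ => /check_op_inj adjT.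
by exists a^*; rewrite -adjointZ -adjT adjointK.
Qed.

End Frobenius.

(** * Averaging over G and scalar products of the operators [check_op] *)

Section Average.
Variables (C : numClosedFieldType) (gT : finGroupType).
Variables (G : {group gT}) (W : urep C G).

Definition average (A : 'End(W)) : 'End(W) :=
  #|G|%:R^-1 *: \sum_(g : subg_of G)
    (ract W (val g) \o (A \o ract W (val g)^-1%g))%VF.

Lemma averageE A w : average A w =
  #|G|%:R^-1 *: \sum_(g : subg_of G) ract W (val g) (A (ract W (val g)^-1%g w)).
Proof.
rewrite scale_lfunE sum_lfunE; congr (_ *: _); apply: eq_bigr => g _.
by rewrite !comp_lfunE.
Qed.

Lemma average_equivariant A : equivariant G (ract W) (ract W) (average A).
Proof.
move=> x Gx w; rewrite !averageE [RHS]linearZ; congr (_ *: _); rewrite [RHS]linear_sum.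
rewrite (reindex_inj (mulgI (subg G x))) /=; apply: eq_bigr => g _.
by rewrite subgK // -!ractMv ?groupV ?groupM ?subgP // invMg -mulgA mulVg mulg1 ractMv ?subgP.
Qed.

Lemma lftrace_average A : lftrace (average A) = lftrace A.
Proof.
rewrite lftraceZ lftrace_sum (eq_bigr (fun=> lftrace A)) => [|g _].
  rewrite sumr_const card_sub (eq_card (B := mem G)) // -(mulr_natr (lftrace A)).
  by rewrite mulrC mulfK // pnatr_eq0 -lt0n cardG_gt0.
rewrite lftraceC; congr lftrace; apply/lfunP=> w; rewrite !comp_lfunE /=.
by rewrite ractK ?subgP.
Qed.

(** The average is scalar by Schur's lemma, and averaging preserves the trace, which fixes the
    scalar. *)
Lemma average_irreducible A : irreducible W ->
  average A = (lftrace A / (\dim {:W})%:R) *: \1%VF.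
Proof.
move=> irrW; have [k avgE] := schur_scalar irrW (@average_equivariant A).
rewrite -lftrace_average avgE lftrace_scalar -mulr_natr mulfK //.
exact: dim_irr_neq0.
Qed.

End Average.

Section CheckDot.
Variables (C : numClosedFieldType) (gT : finGroupType).
Variables (G K : {group gT}) (W : urep C G) (V : urep C K).
Hypotheses (sKG : K \subset G) (irrW : irreducible W).
Let adj := adjoint (rdot V) (rdot W).

(** Moving L2 and the action of g to the left argument turns the sum over G into the average of L2
    L1^*. The two index factors and 1/|K| combine into 1/|G| by Lagrange's theorem. *)
Lemma check_op_dot (L1 L2 : 'Hom(V, W)) w1 w2 :
  ind_dot K (rdot V) (check_op K (adj L1) w1) (check_op K (adj L2) w2) =
    lftrace (adj L1 \o L2)%VF / (\dim {:W})%:R * rdot W w1 w2.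
Proof.
have cE : (sqrtC (#|G : K|%g%:R : C))^-1 * (sqrtC (#|G : K|%g%:R : C))^-1^* =
    #|G : K|%g%:R^-1.
  by rewrite fmorphV /= (CrealP _) ?ger0_real ?sqrtC_ge0 ?ler0n // -invfM -expr2 sqrtCK.
transitivity (rdot W (average (L2 \o adj L1)%VF w1) w2).
  rewrite averageE dotZl dot_suml -(Lagrange sKG) natrM invfM -mulrA /ind_dot.
  congr (_ * _); rewrite mulr_sumr; apply: eq_bigr => g _.
  rewrite !check_opE dotZl dotZr mulrA cE rdot_ractl ?subgP // comp_lfunE /=.
  by rewrite (adjointE (rdot V)).
rewrite average_irreducible // scale_lfunE id_lfunE dotZl; congr (_ / _ * _).
exact: lftraceC.
Qed.

End CheckDot.

(** * Paths *)

Section Path.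
Variables (C : numClosedFieldType) (gT : finGroupType) (n : nat).
Variables (H : nat -> {group gT}) (I : nat -> finType).
Variable rho : forall l, I l -> urep C (H l).
Arguments rho {l} _.
Variable t : I 0%N.
Hypothesis chainH : forall l : nat, (l < n)%N -> H l \subset H l.+1.
Hypothesis irrH : forall l : nat, (l <= n)%N -> complete_irr (@rho l).

Lemma chain_sub0 l : (l <= n)%N -> H 0%N \subset H l.
Proof.
elim: l => [|l IHl] lt_ln; first exact: subxx.
exact: fintype.subset_trans (IHl (ltnW lt_ln)) (chainH lt_ln).
Qed.

Lemma rho_irr l (i : I l) : (l <= n)%N -> irreducible (rho i).
Proof. by case/irrH. Qed.

Lemma rho_hom_eq l (i j : I l) (T : 'Hom(rho i, rho j)) :
    (l <= n)%N -> equivariant (H l) (ract (rho i)) (ract (rho j)) T -> T != 0 ->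
  i = j.
Proof.
move=> le_ln HT nzT; have [_ rho_inj _] := irrH le_ln.
by apply: rho_inj; apply: schur_equivalent HT nzT; exact: rho_irr.
Qed.

Lemma gtpath_end l (c : gtseq I l) : is_gtpath (@rho) t c -> gtJ (@rho) t (gtend c).
Proof. by case: l c => [|l] //= c /and3P[]. Qed.

(** Evaluates one step of [restr_along]: an embedding of rho_i into the image of S pulls back along
    S to a map rho_i -> rho_j, hence to a nonzero multiple of T0. *)
Lemma restr_step (G : {group gT}) (W : urep C G) l (i : I l) (j : I l.+1) (T0 : 'Hom(rho i, rho j))
    (S : 'Hom(rho j, W)) :
    (l < n)%N -> T0 != 0 -> equivariant (H l) (ract (rho i)) (ract (rho j)) T0 ->
    (forall T, equivariant (H l) (ract (rho i)) (ract (rho j)) T ->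
       exists a, T = a *: T0) ->
    equivariant (H l.+1) (ract (rho j)) (ract W) S -> lker S == 0%VS ->
  the_vspace (fun M : {vspace W} =>
    (M <= limg S)%VS /\ affords (rho i) (ract W) M) =
    limg (S \o T0)%VF.
Proof.
move=> lt_ln nzT0 HT0 T0_gen HS kS.
have irr_i : irreducible (rho i) by apply: rho_irr; exact: ltnW.
have HS' := equivariant_sub (chainH lt_ln) HS.
have kT0 := schur_ker0 irr_i HT0 nzT0.
apply: the_vspace_unique.
  split; first by rewrite limg_comp limgS ?subvf.
  apply/affordsP; exists (S \o T0)%VF; split=> //; first exact: equivariant_comp HS' HT0.
  exact: lker0_comp.
move=> M [sMS /affordsP[T [HT kT imT]]].
have sTS : (limg T <= limg S)%VS by rewrite imT.
have [b T_E] := T0_gen _ (equivariant_factor kS sTS HS' HT).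
have ST : T = b *: (S \o T0)%VF.
  rewrite comp_lfunZr -T_E; apply/lfunP=> v; rewrite !comp_lfunE /=.
  by rewrite limg_lfunVK // (subvP sTS) // memv_img ?memvf.
have [v nz_v] := irreducible_neq0 irr_i.
have nz_b : b != 0.
  apply: contra nz_v => /eqP b0; rewrite -memv0 -(eqP kT) memv_ker ST b0.
  by rewrite scale0r zero_lfunE.
by rewrite -imT ST limgZ.
Qed.

Lemma gtpaths_end l (c : gtseq I l) :
  is_gtpath (@rho) t c -> gtpaths (@rho) t (gtend c) c.
Proof. by move=> pc; apply/andP; rewrite eqxx. Qed.

(** One map Lam serves both sides, which is what links restriction and induction. The restriction
    clause is stated for every embedding S of rho_j, because one step down replaces S by S T0. *)
Lemma path_hom l (j : I l) (c : gtseq I l) :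
    (l <= n)%N -> gtpaths (@rho) t j c ->
  exists Lam : 'Hom(rho t, rho j),
    [/\ Lam != 0, equivariant (H 0%N) (ract (rho t)) (ract (rho j)) Lam,
     (forall (G : {group gT}) (W : urep C G) (S : 'Hom(rho j, W)),
        equivariant (H l) (ract (rho j)) (ract W) S -> lker S == 0%VS ->
        restr_along (@rho) (ract W) c (limg S) = limg (S \o Lam)%VF) &
     exists (S : 'Hom(rho j, iter_space (@rho) t l)) (k : C),
       [/\ k != 0, lker S == 0%VS,
           equivariant (H l) (ract (rho j)) (@iter_act _ _ _ _ (@rho) t l) S,
           limg S = iter_sub (@rho) t c &
           forall w, iter_transit (@rho) t l (S w) 1%g =
             k *: adjoint (rdot (rho t)) (rdot (rho j)) Lam w]].
Proof.
elim: l j c => [|l IHl] j c le_ln /=.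
  case/andP=> /= /eqP -> /eqP <-; exists \1%VF; split.
  - have [v nz_v] := irreducible_neq0 (rho_irr t le_ln).
    by apply/lfun_neq0P; exists v; rewrite id_lfunE.
  - exact: equivariant1.
  - by move=> G W S _ _; rewrite comp_lfun1r.
  - exists \1%VF, 1; split; first exact: oner_neq0.
    + by apply/lker0P=> u v; rewrite !id_lfunE.
    + exact: equivariant1.
    + by rewrite lim1g.
    + move=> w; rewrite ind_selfE /= invg1 ract1v id_lfunE scale1r.
      by rewrite (adjoint_unique (S := \1%VF)) ?id_lfunE // => x y; rewrite !id_lfunE.
case: c => c j' /andP[/= /and3P[pc _ /eqP mult1] /eqP eq_j].
rewrite {j'}eq_j in mult1 *; set i := gtend c in mult1 *.
have [Lam [nzL HL restrL [S [k [nz_k kS HS imS transS]]]]] :=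
  IHl i c (ltnW le_ln) (gtpaths_end pc).
have sH := chainH le_ln; have sH0 := chain_sub0 (ltnW le_ln).
have [T0 [nzT0 HT0 T0_gen]] := multiplicity_one sH mult1.
have irr_i : irreducible (rho i) by apply: rho_irr; exact: ltnW.
have irr_j : irreducible (rho j) by apply: rho_irr.
have kT0 := schur_ker0 irr_i HT0 nzT0.
exists (T0 \o Lam)%VF; split.
- have /lfun_neq0P[v nz_v] := nzL; apply/lfun_neq0P; exists v.
  by rewrite comp_lfunE /= -memv_ker (eqP kT0) memv0.
- exact: equivariant_comp (equivariant_sub sH0 HT0) HL.
- move=> G W S' HS' kS'; rewrite (restr_step (T0 := T0)) // restrL ?comp_lfunA //.
    exact: equivariant_comp (equivariant_sub sH HS') HT0.
  exact: lker0_comp.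
set B := adjoint (rdot (rho i)) (rdot (rho j)) T0.
have nzB : B != 0 by rewrite adjoint_eq0.
have HB := adjoint_equivariant (subxx (H l)) sH HT0; rewrite -/B in HB.
pose k0 := (sqrtC (#|H l.+1 : H l|%g%:R : C))^-1.
have nz_k0 : k0 != 0 by rewrite invr_eq0 index_sqrt_neq0.
(* Frobenius reciprocity applied to B = T0^* embeds rho_j into Ind rho_i; applying S to the values
   carries this into Ind Z_l. *)
pose S1 := (ffun_map (subg_of (H l.+1)) S \o check_op (H l) B)%VF.
have S1E w g : S1 w g = k0 *: S (B (ract (rho j) (val g)^-1%g w)).
  by rewrite /S1 comp_lfunE /= ffun_mapE check_opE linearZ.
have HS1 : equivariant (H l.+1) (ract (rho j)) (ind_act (H l.+1) _) S1.
  move=> x Hx w; apply/ffunP=> g; rewrite ind_actE !S1E -ractMv ?groupV ?subgP //=.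
  by rewrite subgK // invMg invgK.
have nzS1 : S1 != 0.
  have /lfun_neq0P[w nzBw] := nzB; apply/lfun_neq0P; exists w.
  apply: contra nzBw => /eqP/ffunP/(_ 1%g).
  rewrite S1E ffunE invg1 ract1v => /eqP; rewrite scaler_eq0 (negPf nz_k0) /= => SBw.
  by rewrite -memv0 -(eqP kS) memv_ker.
have kS1 := schur_ker0 irr_j HS1 nzS1.
exists S1, (k0 * k); split=> //; first by rewrite mulf_neq0.
  apply/esym/the_vspace_unique.
    split; last by apply/affordsP; exists S1.
    apply/subvP=> _ /memv_imgP[w _ ->]; apply/indP; split=> [g|g h Hh].
      by rewrite S1E memvZ // -imS memv_img ?memvf.
    have Hh' := fintype.subsetP sH h Hh.
    rewrite !S1E linearZ /= -HS ?groupV // -HB ?groupV //.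
    by rewrite -ractMv ?groupV ?subgP // subgK // invMg.
  (* Uniqueness of Z_(l+1): for an embedding T into Ind Z_l, evaluation at 1 is an [H l]-map into
     Z_l, the image of S. It factors through rho_i, hence is a multiple of S B, and T is a multiple
     of S1. *)
  move=> M [sM /affordsP[T [HT kT imT]]].
  have Tind w : T w \in ind (H l.+1) (H l) (iter_act (@rho) t l) (iter_sub (@rho) t c).
    by rewrite (subvP sM) // -imT memv_img ?memvf.
  have ev1E w : linfun (fun w => T w 1%g) w = T w 1%g.
    by rewrite linfunE // => b u v; rewrite linearP !ffunE.
  have Hev1 : equivariant (H l) (ract (rho j)) (iter_act (@rho) t l)
      (linfun (fun w => T w 1%g)).
    move=> h Hh w; rewrite !ev1E; have Hh' := fintype.subsetP sH h Hh.
    have /indP[_ indT] := Tind w.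
    rewrite HT // ind_actE mulg1 -[in RHS](invgK h) -indT ?groupV // mul1g.
    by congr (T w _); apply/val_inj; rewrite /= !subgK ?groupV.
  have sev : (limg (linfun (fun w => T w 1%g)) <= limg S)%VS.
    apply/subvP=> _ /memv_imgP[w _ ->]; rewrite ev1E imS.
    by have /indP[] := Tind w.
  have HB' := equivariant_factor kS sev HS Hev1.
  have [b] := T0_gen _ (adjoint_equivariant sH (subxx _) HB').
  move/(congr1 (adjoint (rdot (rho i)) (rdot (rho j)))).
  rewrite adjointK adjointZ -/B => B'E.
  (* The conjugate comes from taking adjoints in the multiplicity one statement; dividing by k0
     removes the normalisation of [check_op]. *)
  have TE : T = (b^* / k0) *: S1.
    apply/lfunP=> w; apply/ffunP=> g; rewrite HomG_eval //.
    rewrite scale_lfunE ffunE S1E scalerA divfK //.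
    rewrite -ev1E -(limg_lfunVK (subvP sev _ (memv_img _ (memvf _)))).
    move/lfunP/(_ (ract (rho j) (val g)^-1%g w)): B'E.
    by rewrite comp_lfunE scale_lfunE /= => ->; rewrite linearZ.
  have [v nz_v] := irreducible_neq0 irr_j.
  have nz_b : b^* / k0 != 0.
    apply: contra nz_v => /eqP b0; rewrite -memv0 -(eqP kT) memv_ker TE b0.
    by rewrite scale0r zero_lfunE.
  by rewrite -imT TE limgZ.
(* At 1 only k0 S (B w) is left, and the induction hypothesis turns it into k0 k Lam^* B w, where
   Lam^* B is the adjoint of T0 Lam. *)
move=> w; rewrite comp_lfunE /= transitE ffun_mapE S1E invg1 ract1v linearZ ffunE.
by rewrite transS scalerA (adjoint_comp _ (rdot (rho i))) comp_lfunE.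
Qed.

(** Reduces the values at an arbitrary group element to values at 1, the only ones that [path_hom]
    describes. *)
Lemma iter_transit_act l x F : x \in H l ->
  iter_transit (@rho) t l (iter_act (@rho) t l x F) 1%g =
  iter_transit (@rho) t l F (subg (H l) x)^-1%g.
Proof.
case: l F => [|l] F Hx /=.
  by rewrite !ind_selfE /= invg1 ract1v subgK // invgK.
by rewrite !comp_lfunE /= !transitE !ffun_mapE ind_actE mulg1.
Qed.

(** * Orthogonality and completeness of the subspaces obtained along paths *)

Section Restriction.
Variables (G : {group gT}) (W : urep C G).

(** Both paths end at j, so they differ below. If they agree at the next level, the induction
    hypothesis applies to S T0; otherwise they pass through inequivalent representations, whose
    images are orthogonal by Schur's lemma. *)
Lemma restr_ortho l (j : I l) (c c' : gtseq I l) (S : 'Hom(rho j, W)) :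
    (l <= n)%N -> H l \subset G ->
    gtpaths (@rho) t j c -> gtpaths (@rho) t j c' -> c' != c ->
    equivariant (H l) (ract (rho j)) (ract W) S -> lker S == 0%VS ->
  {in restr_along (@rho) (ract W) c (limg S) &
      restr_along (@rho) (ract W) c' (limg S), forall u v, rdot W u v = 0}.
Proof.
elim: l j c c' S => [|l IHl] j c c' S le_ln sHG.
  by case/andP=> /= _ /eqP -> /andP[/= _ /eqP ->] /eqP.
case: c c' => [c j1] [c' j2] /andP[/= /and3P[pc _ /eqP m] /eqP eq_j1].
case/andP=> /= /and3P[pc' _ /eqP m'] /eqP eq_j2; move: m m'.
rewrite {}eq_j1 {}eq_j2 xpair_eqE eqxx andbT => m m' neq_c HS kS u v.
have sH := chainH le_ln; have sHG' := fintype.subset_trans sH sHG.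
have irr_l i := rho_irr i (ltnW le_ln).
have HS' := equivariant_sub sH HS.
have [T0 [nzT0 HT0 T0_gen]] := multiplicity_one sH m.
have kT0 := schur_ker0 (irr_l _) HT0 nzT0.
have [eq_c|neq_end] := eqVneq (gtend c') (gtend c).
  have pc'_c : gtpaths (@rho) t (gtend c) c' by rewrite -eq_c gtpaths_end.
  rewrite eq_c (restr_step (T0 := T0)) //.
  apply: (IHl (gtend c)) => //; [exact: ltnW | exact: gtpaths_end | |].
    exact: equivariant_comp HS' HT0.
  exact: lker0_comp.
have [T1 [nzT1 HT1 T1_gen]] := multiplicity_one sH m'.
have kT1 := schur_ker0 (irr_l _) HT1 nzT1.
rewrite (restr_step (T0 := T0)) // (restr_step (T0 := T1)) //.
have [Lam [_ _ LamE _]] := path_hom (ltnW le_ln) (gtpaths_end pc).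
have [Lam' [_ _ Lam'E _]] := path_hom (ltnW le_ln) (gtpaths_end pc').
rewrite (LamE _ _ _ (equivariant_comp HS' HT0) (lker0_comp kS kT0)).
rewrite (Lam'E _ _ _ (equivariant_comp HS' HT1) (lker0_comp kS kT1)).
move=> /memv_imgP[x _ ->] /memv_imgP[y _ ->].
pose adjS := adjoint (rdot (rho j)) (rdot W) S.
pose adjT1 := adjoint (rdot (rho (gtend c'))) (rdot (rho j)) T1.
(* The operator (S T1)^* S T0 intertwines inequivalent irreducible representations, so it vanishes.
   S need not be an isometry. *)
have HQ : equivariant (H l) (ract (rho (gtend c))) (ract (rho (gtend c')))
    (adjT1 \o (adjS \o (S \o T0)))%VF.
  apply: equivariant_comp (adjoint_equivariant (subxx _) sH HT1) _.
  apply: equivariant_comp (equivariant_comp HS' HT0).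
  exact: adjoint_equivariant sH sHG' HS'.
have [Q0|nzQ] := eqVneq (adjT1 \o (adjS \o (S \o T0)))%VF 0; last first.
  by case/eqP: neq_end; rewrite (rho_hom_eq (ltnW le_ln) HQ nzQ).
rewrite !comp_lfunE /= (adjointEr (rdot (rho j))) -/adjS.
rewrite (adjointEr (rdot (rho (gtend c')))) -/adjT1.
move/lfunP/(_ (Lam x)): Q0; rewrite !comp_lfunE zero_lfunE /= => ->.
exact: dot0l.
Qed.

Lemma restr_along_sub l (c : gtseq I l) (i : I l) (S : 'Hom(rho i, W)) :
    (l <= n)%N -> gtpaths (@rho) t i c ->
    equivariant (H l) (ract (rho i)) (ract W) S -> lker S == 0%VS ->
  (restr_along (@rho) (ract W) c (limg S) <= limg S)%VS.
Proof.
move=> le_ln pc HS kS.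
have [Lam [_ _ -> // _]] := path_hom le_ln pc.
by rewrite limg_comp limgS ?subvf.
Qed.

(* Some irreducible T : rho_i -> Res rho_j has T^* S^* P <> 0, and the
   induction applies to S T and to S T T^* S^* P.  As (S T)^* S T is a scalar, the
   product of S T T^* S^* P x with a vector of the image of S T is a multiple of
   the product of P x with it. *)
Lemma restr_complete l (j : I l) (S : 'Hom(rho j, W)) (P : 'Hom(rho t, W)) :
    gelfand_tsetlin (@rho) t n ->
    (l <= n)%N -> H l \subset G ->
    equivariant (H l) (ract (rho j)) (ract W) S -> lker S == 0%VS ->
    equivariant (H 0%N) (ract (rho t)) (ract W) P -> (limg P <= limg S)%VS ->
    P != 0 ->
  exists c, gtpaths (@rho) t j c /\
    exists x v, v \in restr_along (@rho) (ract W) c (limg S) /\ rdot W (P x) v != 0.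
Proof.
move=> GT; elim: l j S P => [|l IHl] j S P le_ln sHG HS kS HP sPS nzP.
  (* At the bottom, S^-1 P is a nonzero map from V to rho_j, which forces j = t; then P x can be
     paired with itself. *)
  have HF := equivariant_factor kS sPS HS HP.
  have /lfun_neq0P[x nzx] := nzP.
  have [F0|nzF] := eqVneq (S^-1 \o P)%VF 0.
    case/eqP: nzx; move/lfunP/(_ x)/(congr1 S): F0; rewrite comp_lfunE /= zero_lfunE.
    by rewrite limg_lfunVK ?(subvP sPS) ?memv_img ?memvf // linear0.
  have eq_tj := rho_hom_eq le_ln HF nzF.
  exists t; split; first by apply/andP; split; rewrite /= ?eq_tj.
  exists x, (P x); split; last by rewrite dnorm_eq0.
  by rewrite /= (subvP sPS) ?memv_img ?memvf.
have sH := chainH le_ln; have sHG' := fintype.subset_trans sH sHG.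
have HS' := equivariant_sub sH HS.
pose adjS := adjoint (rdot (rho j)) (rdot W) S.
have HadjS : equivariant (H l) (ract W) (ract (rho j)) adjS.
  exact: adjoint_equivariant sH sHG' HS'.
have /lfun_neq0P[x nzx] := nzP.
(* P x = S y for some y, so the squared norm of P x is the product of y with S^* P x. *)
have nzSx : adjS (P x) != 0.
  apply: contra nzx => /eqP SP0; rewrite -(dnorm_eq0 (rdot W)).
  have /memv_imgP[y _ Px] := subvP sPS _ (memv_img P (memvf x)).
  by rewrite {2}Px (adjointEr (rdot (rho j))) -/adjS SP0 dot0l.
have [i [T [HT nzT]]] := exists_adjoint_neq0 sH (irrH (ltnW le_ln)) nzSx.
set adjT := adjoint _ _ T in nzT.
have HadjT : equivariant (H l) (ract (rho j)) (ract (rho i)) adjT.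
  exact: adjoint_equivariant (subxx _) sH HT.
have nzT0 : T != 0.
  apply: contra nzT; rewrite -(adjoint_eq0 (rdot (rho i)) (rdot (rho j))).
  by rewrite -/adjT => /eqP->; rewrite zero_lfunE.
have irr_i := rho_irr i (ltnW le_ln).
have kT := schur_ker0 irr_i HT nzT0.
have HST := equivariant_comp HS' HT; have kST := lker0_comp kS kT.
have sH0 := chain_sub0 (ltnW le_ln).
have HP' : equivariant (H 0%N) (ract (rho t)) (ract W)
    ((S \o T) \o (adjT \o (adjS \o P)))%VF.
  apply: (equivariant_comp (equivariant_sub sH0 HST)).
  apply: (equivariant_comp (equivariant_sub sH0 HadjT)).
  exact: equivariant_comp (equivariant_sub sH0 HadjS) HP.
have [||c [pc [y [v [vc nz_yv]]]]] := IHl i (S \o T)%VF _ (ltnW le_ln) sHG' HST kST HP'.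
- by rewrite limg_comp limgS ?subvf.
- apply/lfun_neq0P; exists x; rewrite comp_lfunE /=.
  by apply: contra nzT; rewrite -memv_ker (eqP kST) memv0 !comp_lfunE.
have /andP[/= is_c /eqP c_i] := pc.
have mult_gt0 : (0 < ind_mult (@rho) i j)%N by exact: multiplicity_gt0 HT nzT0.
(* Membership in [gtJ] is not assumed: for i it is read off from the path c given by induction, and
   for j it follows from the nonzero T. *)
have Ji : gtJ (@rho) t i by rewrite -c_i gtpath_end.
have Jj : gtJ (@rho) t j by apply/existsP; exists i; apply/andP.
have mult1 : ind_mult (@rho) i j = 1%N.
  by apply/eqP; rewrite eqn_leq mult_gt0 GT.
have [T0 [_ _ T0_gen]] := multiplicity_one sH mult1.
(* Being nonzero, T generates the same line as T0, so [restr_step] can be used with T itself. *)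
have T_gen T' : equivariant (H l) (ract (rho i)) (ract (rho j)) T' -> exists a, T' = a *: T.
  have [b TE] := T0_gen _ HT; move=> /T0_gen[b' ->]; exists (b' / b).
  rewrite TE scalerA divfK //; apply: contra nzT0 => /eqP b0.
  by rewrite TE b0 scale0r.
exists (c, j); split; first by apply/andP; split=> //; apply/and3P; split; rewrite //= c_i mult1.
exists y, v; split; first by rewrite /= c_i (restr_step (T0 := T)).
apply: contra nz_yv => /eqP yv0.
have /memv_imgP[z _ vE] := subvP (restr_along_sub (ltnW le_ln) pc HST kST) _ vc.
have [b adjE] : exists b, (adjT \o (adjS \o (S \o T)))%VF = b *: \1%VF.
  apply: (schur_scalar irr_i); apply: (equivariant_comp HadjT).
  exact: equivariant_comp HadjS HST.
move/lfunP/(_ z): adjE; rewrite scale_lfunE id_lfunE !comp_lfunE /= => adjE.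
rewrite vE !comp_lfunE /= (adjointE (rdot (rho j))) -/adjS.
rewrite (adjointE (rdot (rho i))) -/adjT adjE dotZr -!adjointEr.
by move: yv0; rewrite vE comp_lfunE /= => ->; rewrite mulr0.
Qed.

End Restriction.
End Path.

(** * The basis indexed by the paths *)

Section Main.
Variables (C : numClosedFieldType) (gT : finGroupType) (n : nat).
Variables (H : nat -> {group gT}) (I : nat -> finType).
Variable rho : forall l, I l -> urep C (H l).
Arguments rho {l} _.
Variables (t : I 0%N) (s : I n) (L : gtseq I n -> 'Hom(rho t, rho s)).
Hypothesis chainH : forall l : nat, (l < n)%N -> H l \subset H l.+1.
Hypothesis irrH : forall l : nat, (l <= n)%N -> complete_irr (@rho l).
Hypothesis GT : gelfand_tsetlin (@rho) t n.
Hypothesis isoL : forall c, gtpaths (@rho) t s c -> path_isometry c (L c).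

Let V := rho t.
Let W := rho s.
Let T c := path_op (L c).
Let adj := adjoint (rdot V) (rdot W).
Let ratio := sqrtC ((\dim {:W})%:R / (\dim {:V})%:R : C).
Let U := gt_ind (@rho) t n.
Let HomU := HomG W (ind_act (H n) V) U.

Let sH0 : H 0%N \subset H n. Proof. exact: (chain_sub0 chainH (leqnn n)). Qed.
Let irrV : irreducible V. Proof. exact: (rho_irr irrH t (leq0n n)). Qed.
Let irrW : irreducible W. Proof. exact: (rho_irr irrH s (leqnn n)). Qed.

Lemma ratio_neq0 : ratio != 0.
Proof. by rewrite sqrtC_eq0 mulf_neq0 ?invr_eq0 ?dim_irr_neq0. Qed.

Lemma path_isometry_equivariant c : gtpaths (@rho) t s c ->
  equivariant (H 0%N) (ract V) (ract W) (L c).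
Proof. by case/isoL=> /HomGP[_ /intertwinesP]. Qed.

Lemma adj_path_equivariant c : gtpaths (@rho) t s c ->
  equivariant (H 0%N) (ract W) (ract V) (adj (L c)).
Proof. by move/path_isometry_equivariant; exact: adjoint_equivariant. Qed.

(** The diagonal case is the isometry property; the other one is the orthogonality of V_C and V_C',
    from [restr_ortho] with S the identity of W. *)
Lemma adj_path_isometry c c' : gtpaths (@rho) t s c -> gtpaths (@rho) t s c' ->
  (adj (L c) \o L c')%VF = (c == c')%:R *: \1%VF.
Proof.
move=> pc pc'; apply/lfunP=> v; apply: (dot_inj (d := rdot V)) => u.
rewrite comp_lfunE /= -adjointE scale_lfunE id_lfunE dotZr conjC_nat.
have [_ isoLc imLc] := isoL pc; have [_ _ imLc'] := isoL pc'.
have [eq_c|neq_c] := eqVneq c c'; first by rewrite mul1r -eq_c isoLc.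
rewrite mul0r.
have mem_path d : limg (L d) = restr_space (@rho) s d -> forall x,
    L d x \in restr_along (@rho) (ract W) d (limg (\1%VF : 'End(W))).
  by move=> imL x; rewrite lim1g -[restr_along _ _ _ _]imL memv_img ?memvf.
apply: (restr_ortho chainH irrH (leqnn n) (subxx _) pc pc' _
  (@equivariant1 _ _ _ _ _)); try exact: mem_path; first by rewrite eq_sym.
by apply/lker0P=> x y; rewrite !id_lfunE.
Qed.

(** The trace of L_C^* L_C' is d_theta or 0, and [check_op_dot] divides it by d_sigma; the squared
    factor d_sigma / d_theta compensates exactly. *)
Lemma path_op_dot c c' w1 w2 : gtpaths (@rho) t s c -> gtpaths (@rho) t s c' ->
  gt_dot (@rho) t n (T c w1) (T c' w2) = (c == c')%:R * rdot W w1 w2.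
Proof.
move=> pc pc'; rewrite /T /path_op !scale_lfunE -/ratio dotZl dotZr mulrA.
rewrite [gt_dot _ _ _ _ _](check_op_dot sH0 irrW) adj_path_isometry //.
rewrite lftrace_scalar -/ratio.
have -> : ratio * ratio^* = (\dim {:W})%:R / (\dim {:V})%:R.
  by rewrite (CrealP _) -?expr2 ?sqrtCK // ger0_real // sqrtC_ge0 divr_ge0 ?ler0n.
rewrite mulrA; congr (_ * _); rewrite -(mulr_natr (c == c')%:R) mulrC mulrA.
by rewrite divfK ?mulfK ?dim_irr_neq0.
Qed.

Lemma path_op_HomG c : gtpaths (@rho) t s c -> T c \in HomU.
Proof.
move=> pc; rewrite memvZ //; apply: check_op_HomG => //.
exact: adj_path_equivariant.
Qed.

Lemma path_op_hom_dot c c' : gtpaths (@rho) t s c -> gtpaths (@rho) t s c' ->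
  hom_dot (rdot W) (gt_dot (@rho) t n) (T c) (T c') = (c == c')%:R.
Proof.
move=> pc pc'; rewrite /hom_dot.
have -> : (adjoint (rdot W) (gt_dot (@rho) t n) (T c') \o T c)%VF =
    (c == c')%:R *: \1%VF.
  apply/lfunP=> w; apply: (dot_inj (d := rdot W)) => u.
  rewrite comp_lfunE /= -adjointE path_op_dot // scale_lfunE id_lfunE dotZr.
  by rewrite conjC_nat eq_sym.
by rewrite lftrace_scalar -(mulr_natr (c == c')%:R) mulrCA mulVf ?mulr1 ?dim_irr_neq0.
Qed.

Lemma HomU_path_op (S : 'Hom(W, {ffun subg_of (H n) -> V})) : S \in HomU ->
  S \in (\sum_(c | gtpaths (@rho) t s c) <[T c]>)%VS.
Proof.
move/(HomG_check_op sH0) => [B HB ->].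
(* The coefficients b_C, given by Schur's lemma on V; 0 is a default outside the paths. *)
have /choice[lam lamE] c : exists k, gtpaths (@rho) t s c ->
    (B \o L c)%VF = k *: \1%VF.
  have [pc|_] := boolP (gtpaths (@rho) t s c); last by exists 0.
  have [|k BL] := schur_scalar (T := (B \o L c)%VF) irrV; last by exists k.
  by apply: equivariant_comp HB _; exact: path_isometry_equivariant.
pose D := B - \sum_(c | gtpaths (@rho) t s c) lam c *: adj (L c).
have DL c : gtpaths (@rho) t s c -> (D \o L c)%VF = 0.
  move=> pc; have adjE c' v : gtpaths (@rho) t s c' ->
      adj (L c') (L c v) = (c' == c)%:R *: v.
    move=> pc'; have /lfunP/(_ v) := adj_path_isometry pc' pc.
    by rewrite comp_lfunE scale_lfunE id_lfunE.
  apply/lfunP=> v; rewrite zero_lfunE comp_lfunE /= !add_lfunE opp_lfunE sum_lfunE.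
  rewrite -comp_lfunE lamE // (bigD1 c) //= big1 => [|c' /andP[pc' neq_c]].
    by rewrite !scale_lfunE id_lfunE adjE // eqxx scale1r addr0 subrr.
  by rewrite scale_lfunE adjE // (negPf neq_c) scale0r scaler0.
have HD : equivariant (H 0%N) (ract W) (ract V) D.
  move=> x Hx w; rewrite !add_lfunE !opp_lfunE HB // !sum_lfunE linearB; congr (_ - _).
  rewrite linear_sum; apply: eq_bigr => c pc; rewrite !scale_lfunE linearZ.
  by rewrite (adj_path_equivariant pc).
(* If D^* were nonzero, [restr_complete] would give a vector L_C y not orthogonal to some D^* x,
   against D L_C = 0. *)
have D0 : D = 0.
  apply/eqP; rewrite -(adjoint_eq0 (rdot W) (rdot V)); apply/negPn/negP => nzD.
  have k1 : lker (\1%VF : 'End(W)) == 0%VS by apply/lker0P=> u v; rewrite !id_lfunE.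
  have s1 : (limg (adjoint (rdot W) (rdot V) D) <= limg (\1%VF : 'End(W)))%VS.
    by rewrite lim1g subvf.
  have [c [pc [x [v [vc]]]]] := restr_complete chainH irrH GT (leqnn n)
    (subxx (H n)) (@equivariant1 _ _ _ _ _) k1
    (adjoint_equivariant sH0 (subxx _) HD) s1 nzD.
  have [_ _ imL] := isoL pc; move: vc; rewrite lim1g -[restr_along _ _ _ _]imL.
  move=> /memv_imgP[y _ ->]; rewrite -adjointEr.
  by move/lfunP/(_ y): (DL c pc); rewrite comp_lfunE zero_lfunE /= => ->; rewrite dot0r eqxx.
have -> : B = \sum_(c | gtpaths (@rho) t s c) lam c *: adj (L c).
  by apply/eqP; rewrite -subr_eq0 -/D D0.
rewrite linear_sum; apply: memv_sumr => c pc.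
rewrite linearZ memvZ //; apply/vlineP; exists ratio^-1.
by rewrite /T /path_op scalerA mulVf ?ratio_neq0 // scale1r.
Qed.

Lemma sum_path_op : (\sum_(c | gtpaths (@rho) t s c) <[T c]>)%VS = HomU.
Proof.
apply/eqP; rewrite eqEsubv; apply/andP; split; last exact/subvP/HomU_path_op.
by apply/subv_sumP => c pc; rewrite -memvE path_op_HomG.
Qed.

Lemma path_op_neq0 c : gtpaths (@rho) t s c -> T c != 0.
Proof.
move=> pc; apply/eqP => T0; have [w nz_w] := irreducible_neq0 irrW.
have := path_op_dot w w pc pc; rewrite T0 zero_lfunE dot0l eqxx mul1r => /esym/eqP.
by rewrite dnorm_eq0 (negPf nz_w).
Qed.

(** The lines spanned by the T c are independent: evaluating a linear relation at some w != 0 and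
    pairing it with [T c w] isolates the coefficient of c. *)
Lemma card_gtpaths : #|gtpaths (@rho) t s| = \dim HomU.
Proof.
have direct_T : directv (\sum_(c | gtpaths (@rho) t s c) <[T c]>).
  apply/directv_sum_independent => us us_T sum0 c pc.
  have /choice[k kE] c' : exists k, gtpaths (@rho) t s c' -> us c' = k *: T c'.
    have [/us_T/vlineP[k]|_] := boolP (gtpaths (@rho) t s c'); first by exists k.
    by exists 0.
  rewrite kE //; have [w nz_w] := irreducible_neq0 irrW.
  move/lfunP/(_ w)/(congr1 (gt_dot (@rho) t n ^~ (T c w))): sum0.
  rewrite sum_lfunE dot_suml zero_lfunE dot0l (bigD1 c) //= big1 => [|c' /andP[pc' neq_c]].
    rewrite addr0 kE // scale_lfunE dotZl path_op_dot // eqxx mul1r => /eqP.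
    by rewrite mulf_eq0 dnorm_eq0 (negPf nz_w) orbF => /eqP ->; rewrite scale0r.
  by rewrite kE // scale_lfunE dotZl path_op_dot // (negPf neq_c) mul0r mulr0.
rewrite -sum_path_op (directvP direct_T) /= -sum1_card.
by apply: eq_bigr => c pc; rewrite dim_vline path_op_neq0.
Qed.

Lemma ind_path_spaceE c : gtpaths (@rho) t s c ->
  ind_path_space (@rho) t c = limg (T c).
Proof.
move=> pc; have [Lam [nzL HL restrL [S [k [nz_k _ HS imS transS]]]]] :=
  path_hom chainH irrH (leqnn n) pc.
have kL := schur_ker0 irrV HL nzL; have [_ _ imL] := isoL pc.
have imLam : limg (L c) = limg Lam.
  have k1 : lker (\1%VF : 'End(W)) == 0%VS by apply/lker0P=> u v; rewrite !id_lfunE.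
  by rewrite imL; have := restrL _ _ _ (@equivariant1 _ _ _ _ _) k1; rewrite lim1g comp_lfun1l.
have sLL : (limg (L c) <= limg Lam)%VS by rewrite imLam.
(* L_C and Lam are injective with the same image V_C, so they differ by an automorphism of V, a
   scalar. *)
have [a LE] := schur_scalar irrV
  (equivariant_factor kL sLL HL (path_isometry_equivariant pc)).
have {}LE : L c = a *: Lam.
  apply/lfunP=> v; rewrite -(limg_lfunVK (subvP sLL _ (memv_img (L c) (memvf v)))).
  by move/lfunP/(_ v): LE; rewrite comp_lfunE !scale_lfunE id_lfunE /= => ->; rewrite linearZ.
have nz_a : a != 0.
  have [v nz_v] := irreducible_neq0 irrV; apply: contra nz_v => /eqP a0.
  have [_ dotL _] := isoL pc; rewrite -(dnorm_eq0 (rdot V)) -dotL LE a0.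
  by rewrite scale0r zero_lfunE dot0l.
(* Here k comes from [path_hom] and the conjugate of a from L_C = a Lam; the root of the index and
   [ratio] undo the normalisations in [check_op] and [path_op]. *)
have transE : (iter_transit (@rho) t n \o S)%VF =
    (k / a^* * sqrtC #|H n : H 0%N|%g%:R / ratio) *: T c.
  apply/lfunP=> w; apply/ffunP=> g; rewrite comp_lfunE /= scale_lfunE ffunE.
  have -> : iter_transit (@rho) t n (S w) g =
      iter_transit (@rho) t n (S (ract W (val g)^-1%g w)) 1%g.
    rewrite HS ?groupV ?subgP // iter_transit_act ?groupV ?subgP //.
    by congr (_ _ _); apply/val_inj; rewrite /= subgK ?groupV ?subgP // invgK.
  rewrite transS /T /path_op scale_lfunE ffunE check_opE LE /adj adjointZ scale_lfunE.
  rewrite !scalerA; congr (_ *: _).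
  by rewrite -/ratio divfK ?ratio_neq0 // mulfK ?index_sqrt_neq0 // divfK ?fmorph_eq0.
have nz : k / a^* * sqrtC #|H n : H 0%N|%g%:R / ratio != 0.
  by rewrite !mulf_neq0 ?invr_eq0 ?ratio_neq0 ?fmorph_eq0 ?index_sqrt_neq0.
by rewrite /ind_path_space -imS -limg_comp transE limgZ.
Qed.

(** An embedding of W into U is a combination of the T c, so its image lies in the sum; conversely
    each image of T c affords W, so the sum is the least such subspace. *)
Lemma isotypicE :
  (\sum_(c | gtpaths (@rho) t s c) limg (T c))%VS =
  isotypic W (ind_act (H n) V) U.
Proof.
set S0 := (\sum_(c | _) _)%VS.
have S0_ub M : (M <= U)%VS -> affords W (ind_act (H n) V) M -> (M <= S0)%VS.
  move=> sMU [S [HS kS imS]].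
  have /HomU_path_op/memv_sumP[us us_T SE] : S \in HomU.
    by apply/HomGP; split=> // w; rewrite (subvP sMU) // -imS memv_img ?memvf.
  rewrite -imS; apply/subvP=> _ /memv_imgP[w _ ->]; rewrite SE sum_lfunE.
  apply: memv_sumr => c pc; have /vlineP[k ->] := us_T c pc.
  by rewrite scale_lfunE memvZ // memv_img ?memvf.
have S0_le M : (forall M', (M' <= U)%VS -> affords W (ind_act (H n) V) M' ->
    (M' <= M)%VS) -> (S0 <= M)%VS.
  move=> sub_M; apply/subv_sumP => c pc; have /HomGP[imT HT] := path_op_HomG pc.
  apply: sub_M; first by apply/subvP=> _ /memv_imgP[w _ ->].
  exists (T c); split=> //; move/intertwinesP: HT => HT.
  exact: schur_ker0 irrW HT (path_op_neq0 pc).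
apply/esym/the_vspace_unique => // M [M_ub M_le].
by apply/eqP; rewrite eqEsubv M_le // S0_le.
Qed.

End Main.

Local Open Scope complex_scope.

Theorem theorem6p2 (R : realType) (gT : finGroupType) (n : nat)
    (H : nat -> {group gT}) (I : nat -> finType)
    (rho : forall l : nat, I l -> urep R[i] (H l))
    (t : I 0%N) (s : I n)
    (L : gtseq I n -> 'Hom(rho 0%N t, rho n s))
    (chainH : forall l : nat, (l < n)%N -> H l \subset H l.+1)
    (irrH : forall l : nat, (l <= n)%N -> complete_irr (rho l))
    (GT : gelfand_tsetlin rho t n)
    (sJ : (0 < multiplicity (rho n s) (ind_act (H n) (rho 0%N t)) (gt_ind rho t n))%N)
    (isoL : forall c : gtseq I n, gtpaths rho t s c ->
       path_isometry c (L c)) :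
  let T (c : gtseq I n) := path_op (L c) in
  [/\ orthonormal_basis (hom_dot (rdot (rho n s)) (gt_dot rho t n))
        (gtpaths rho t s) T
        (HomG (rho n s) (ind_act (H n) (rho 0%N t)) (gt_ind rho t n)),
      isometric_decomposition (ind_act (H n) (rho 0%N t)) (gt_dot rho t n)
        (gt_ind rho t n) (gtpaths rho t s) T,
      (\sum_(c | gtpaths rho t s c) ind_path_space rho t c)%VS =
        isotypic (rho n s) (ind_act (H n) (rho 0%N t)) (gt_ind rho t n) &
      forall c : gtseq I n, gtpaths rho t s c ->
        ind_path_space rho t c = limg (T c)].
Proof.
move=> T; split.
- split=> [c c' pc pc'|]; first exact: (path_op_hom_dot chainH irrH isoL).
  exact: (sum_path_op chainH irrH GT isoL).
- split=> [|c pc|c c' w1 w2 pc pc'].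
  + exact: (card_gtpaths chainH irrH GT isoL).
  + exact: (path_op_HomG chainH isoL).
  + exact: (path_op_dot chainH irrH isoL).
- rewrite -(isotypicE chainH irrH GT isoL); apply: eq_bigr => c pc.
  exact: (ind_path_spaceE chainH irrH isoL).
- by move=> c pc; apply: (ind_path_spaceE chainH irrH isoL).
Qed.
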